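(* Let $k$ be a field, $R = k[x,y]$ and $\mathfrak{m} = (x,y)$. Let $I, J$ be $\mathfrak{m}$-primary complete monomial ideals in $R$. For all integers $m,n \ge 0$, $$\ell(R/I^mJ^n) = s_I m^2 + s_J n^2 + (s_{IJ} - s_I - s_J)mn + \frac{1}{2}(a_I + b_I - l_I + 1)m + \frac{1}{2}(a_J + b_J - l_J + 1)n.$$
   Context: An ideal is called complete if it is integrally closed, i.e. equal to its integral closure. $\ell(\cdot)$ denotes length as an $R$-module; $I^0 = R$. For an $\mathfrak{m}$-primary complete monomial ideal $I$ of $R = k[x,y]$ (products of such ideals are again of this type): the Newton polyhedron $N(I) \subset \mathbb{R}^2$ is the convex hull of the exponent vectors of all monomials in $I$. The Newton boundary $B(I)$ is the union of the compact faces of $N(I)$. Its end points on the axes are denoted $(a_I,0)$ and $(0,b_I)$. $l_I$ is the number of lattice points (points of $\mathbb{Z}^2$) in $B(I)$. $\overline{P(I)}$ is the (closed) polygon bounded by $B(I)$ and the two line segments connecting the origin $(0,0)$ with $(a_I,0)$ and with $(0,b_I)$. $s_I$ is the area of $\overline{P(I)}$. *)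

(* Defs.v *)
From HB Require Import structures.
From mathcomp Require Import all_boot all_order all_algebra.
From mathcomp Require Import generic_quotient ring_quotient finmap.
From mathcomp Require Import all_classical all_reals all_analysis.
(* The notations of mpoly clash with those of mathcomp-analysis. *)
From mathcomp Require Import -(notations) mpoly.

Set Implicit Arguments.
Unset Strict Implicit.
Unset Printing Implicit Defensive.

Import Order.TTheory GRing.Theory Num.Theory.
Import numFieldNormedType.Exports.

Local Open Scope classical_set_scope.
Local Open Scope ring_scope.

Section Submodules.
Variables (A : pzRingType) (M : lmodType A).

Definition span_pred (G : set M) : M -> bool :=
  fun x => `[< forall N : submodClosed M, G `<=` [set` N] -> x \in N >].

Fact span_submod_closed G : GRing.submod_closed (span_pred G).
Proof.
split; first by apply/asboolP => N _; exact: rpred0.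
move=> a u v /asboolP uG /asboolP vG; apply/asboolP => N GN.
by rewrite rpredD ?rpredZ ?uG ?vG.
Qed.

Definition span (G : set M) : submodClosed M :=
  HB.pack (span_pred G)
    (GRing.isSubmodClosed.Build A M (span_pred G) (span_submod_closed G)).

Definition submod_pred (N : submodClosed M) : M -> bool := fun x => x \in N.

Fact submod_zmod_closed N : GRing.zmod_closed (submod_pred N).
Proof.
split; first exact: (rpred0 N).
move=> u v uN vN; change (u - v \in N).
by rewrite -scaleN1r rpredD ?rpredZ.
Qed.

Definition submod_zmod (N : submodClosed M) : zmodClosed M :=
  HB.pack (submod_pred N)
    (GRing.isZmodClosed.Build M (submod_pred N) (submod_zmod_closed N)).

End Submodules.

Section QuotientModule.
Local Open Scope quotient_scope.
Variables (A : pzRingType) (M : lmodType A) (N : submodClosed M).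

Definition quot_mod : Type := Quotient.quot (submod_zmod N).

HB.instance Definition _ := GRing.Zmodule.on quot_mod.
HB.instance Definition _ := EqQuotient.on quot_mod.

Fact pi_quot_add (x y : M) :
  \pi_quot_mod (x + y) = \pi_quot_mod x + \pi_quot_mod y.
Proof. exact: (@Quotient.pi_add _ (submod_zmod N)). Qed.

Definition quot_scale (a : A) : quot_mod -> quot_mod :=
  lift_op1 quot_mod ( *:%R a).

Fact pi_quot_scale a (x : M) :
  quot_scale a (\pi_quot_mod x) = \pi_quot_mod (a *: x).
Proof.
unlock quot_scale; apply/eqP.
have := @Quotient.idealrBE _ (submod_zmod N).
rewrite /quot_mod => <-; change (a *: repr (\pi_quot_mod x) - a *: x \in N).
rewrite -scalerBr rpredZ //.
change (repr (\pi_quot_mod x) - x \in submod_zmod N).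
by rewrite Quotient.idealrBE reprK.
Qed.

Fact quot_scaleA a b (x : quot_mod) :
  quot_scale a (quot_scale b x) = quot_scale (a * b) x.
Proof. by rewrite -[x]reprK !pi_quot_scale scalerA. Qed.

Fact quot_scale1 : left_id 1 quot_scale.
Proof. by move=> x; rewrite -[x]reprK pi_quot_scale scale1r. Qed.

Fact quot_scaleDr : right_distributive quot_scale +%R.
Proof.
move=> a x y; rewrite -[x]reprK -[y]reprK.
by rewrite -pi_quot_add !pi_quot_scale scalerDr pi_quot_add.
Qed.

Fact quot_scaleDl x : {morph quot_scale^~ x : a b / a + b}.
Proof.
move=> a b; by rewrite -[x]reprK !pi_quot_scale scalerDl pi_quot_add.
Qed.

HB.instance Definition _ := GRing.Zmodule_isLmodule.Build A quot_mod
  quot_scaleA quot_scale1 quot_scaleDr quot_scaleDl.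

End QuotientModule.

(* The length of M, an extended real: the supremum of the lengths n of the chains
   N_0 < N_1 < ... < N_n of submodules of M (infinite if they are unbounded). *)
Definition length (R : realType) (A : pzRingType) (M : lmodType A) : \bar R :=
  ereal_sup [set n%:R%:E | n in [set n : nat |
    exists N : nat -> submodClosed M,
      forall i, (i < n)%N -> [set` N i] `<` [set` N i.+1]]].

Section Ideals.
Variable A : comNzRingType.

Definition ideal := submodClosed A^o.

Definition ideal_gen (G : set A) : ideal := span (G : set A^o).

Definition ideal_mul (I J : ideal) : ideal :=
  ideal_gen [set a * b | a in [set` I] & b in [set` J]].

Definition ideal_exp (I : ideal) (n : nat) : ideal :=
  iter n (ideal_mul I) (ideal_gen setT).

Definition radical (I : ideal) : set A :=
  [set x | exists n, x ^+ n \in I].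

Definition primary (I : ideal) : Prop :=
  1 \notin I /\
  forall x y : A, x * y \in I -> x \in I \/ exists n, y ^+ n \in I.

Definition primary_to (P I : ideal) : Prop :=
  primary I /\ radical I = [set` P].

Definition integral_closure (I : ideal) : set A :=
  [set x | exists (n : nat) (a : nat -> A),
    [/\ (0 < n)%N,
        forall i, (1 <= i <= n)%N -> a i \in ideal_exp I i
      & x ^+ n + \sum_(1 <= i < n.+1) a i * x ^+ (n - i) = 0]].

Definition complete (I : ideal) : Prop := [set` I] = integral_closure I.

End Ideals.

Section PolynomialIdeals.
Variable k : fieldType.

Let x0 : 'I_2 := ord0.
Let x1 : 'I_2 := ord_max.

Definition max_ideal : ideal (mpoly 2 k) :=
  ideal_gen [set mpolyX k (mnm1 x0); mpolyX k (mnm1 x1)].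

Definition monomial_ideal (I : ideal (mpoly 2 k)) : Prop :=
  exists S : set (multinom 2), [set` I] = [set` ideal_gen (mpolyX k @` S)].

Variable R : realType.

Definition exponents (I : ideal (mpoly 2 k)) : set (R * R) :=
  [set ((u x0)%:R, (u x1)%:R) | u in [set u : multinom 2 | mpolyX k u \in I]].

End PolynomialIdeals.

Arguments exponents {k} R I.

Section Plane.
Variable R : realType.
Implicit Types (P F C : set (R * R)) (p : R * R).

Definition convex_hull (G : set (R * R)) : set (R * R) :=
  smallest (@convex_set R (R * R)%type) G.

(* The faces of a polyhedron: its intersections with the lines c.p = d
   such that it lies in the half-plane c.p >= d.  The case c = 0 only adds the
   improper faces P and set0. *)
Definition face P F : Prop :=
  exists (c : R * R) (d : R),
    (forall p, P p -> d <= c.1 * p.1 + c.2 * p.2) /\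
    F = P `&` [set p | c.1 * p.1 + c.2 * p.2 = d].

Definition compact_faces P : set (R * R) :=
  \bigcup_(F in [set F | face P F /\ compact F]) F.

(* The closed region bounded by a closed curve C: the curve together with the
   bounded connected components of its complement. *)
Definition region C : set (R * R) :=
  C `|` [set p | ~ C p /\ bounded_set (connected_component (~` C) p)].

Definition area P : R := fine ((lebesgue_measure \x lebesgue_measure)%E P).

End Plane.

Section NewtonPolygon.
Variables (R : realType) (k : fieldType) (I : ideal (mpoly 2 k)).

Definition newton_polyhedron : set (R * R) := convex_hull (exponents R I).

Definition newton_boundary : set (R * R) := compact_faces newton_polyhedron.

(* For an (x, y)-primary monomial ideal the boundary meets each axis in exactly
   one point. *)
Definition end_x : R := xget 0 [set a | newton_boundary (a, 0)].
Definition end_y : R := xget 0 [set b | newton_boundary (0, b)].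

Definition boundary_points : nat :=
  #|` fset_set [set z : int * int | newton_boundary (z.1%:~R, z.2%:~R)] |.

Definition newton_polygon : set (R * R) :=
  region (newton_boundary
    `|` [set (t, 0) | t in `[0, end_x]] `|` [set (0, t) | t in `[0, end_y]]).

Definition polygon_area : R := area newton_polygon.

End NewtonPolygon.

Arguments newton_polyhedron R {k} I.
Arguments newton_boundary R {k} I.
Arguments newton_polygon R {k} I.

(* Main.v *)
From HB Require Import structures.
Require Import Defs.
From mathcomp Require Import all_boot all_order all_algebra.
From mathcomp Require Import generic_quotient ring_quotient finmap.
From mathcomp Require Import all_classical all_reals all_analysis.
From mathcomp Require Import measurable_realfun.
From mathcomp Require Import -(notations) mpoly.
From mathcomp Require Import ring lra zify.

(** The Newton boundary of a complete monomial ideal is a convex lattice path from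
(0, b) to (a, 0). Cutting it at all of its lattice points gives a list L of primitive
steps (p, q), going right by p and down by q, sorted from the steepest to the
flattest, and the exponents of the ideal are the lattice points on or above this path
(lattice_convex_path, complete_has_path). All the numbers in the formula can be read
off from the multiset of steps: a is the sum of the p, b is the sum of the q, and
l - 1 is the number of steps. Since the slopes are sorted, the area below the path is
half of the sum of min(p q', p' q) over all ordered pairs of steps (p, q), (p', q');
this sum is called mixed L L.

The multiset of steps is additive for products of ideals. Exponents of a product are
sums of exponents, so a product corresponds to a Minkowski sum, and the region above
a sorted path is the Minkowski sum of the regions above its single steps, even on the
level of lattice points (above_msum, msumP). Hence I^m J^n belongs to the list made
of m copies of the list of I and n copies of the list of J (has_path_mul,
has_path_exp). Then a, b and l - 1 are linear
in m and n, and the area is a quadratic form in m and n, whose mixed coefficient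
is that of the case m = n = 1.

For a monomial ideal K, the length of R/K is the number of monomials outside K
(length_monomial_le, length_monomial_ge), that is, of lattice points below the path.
Counting them column by column gives Pick's formula

  2 N = mixed L L + a + b - (l - 1)

(below_size), because below a single primitive step (p, q) there are
(p q + p + q - 1) / 2 lattice points and the rest is a union of rectangles.

What is left is to identify the geometric notions. The path is the graph of a convex
piecewise linear function, the profile. The convex hull of the exponents is its
epigraph (convex_hull_lattice), the compact faces form its graph over [0, a]
(compact_faces_epigraph), the closed curve bounds the points between the axes and the
graph (region_newton_curve), and the area of these is the integral of the profile
(integral_profile). *)

Set Implicit Arguments.
Unset Strict Implicit.
Unset Printing Implicit Defensive.

Import Order.TTheory GRing.Theory Num.Theory.
Import numFieldNormedType.Exports.

Local Open Scope ring_scope.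

(** * Convex lattice paths *)

Section LatticePaths.
Local Open Scope nat_scope.

(** A step (p, q) is the segment that goes right by p and down by q. It stands for
the polyhedron q x + p y >= p q of the quadrant, whose compact edge is that segment. *)
Definition step : Type := (nat * nat)%type.

Implicit Types (v w : step) (L : seq step) (x y : nat).

Definition primitive v := [&& 0 < v.1, 0 < v.2 & coprime v.1 v.2].

Definition steeper v w := w.2 * v.1 <= v.2 * w.1.

Definition width L := \sum_(v <- L) v.1.
Definition height L := \sum_(v <- L) v.2.

Definition convex_path L := all primitive L && pairwise steeper L.

(** The path of L starts at height (height L) on the vertical axis and follows the
steps in order; the test is made in the column of the point, against the step
that crosses this column, and to the right of the path it always succeeds. *)
Fixpoint above L x y : bool :=
  if L is v :: L' then
    if x < v.1 then v.1 * (v.2 + height L') <= v.2 * x + v.1 * y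
    else above L' (x - v.1) y
  else true.

Lemma width_nil : width [::] = 0.
Proof. by rewrite /width big_nil. Qed.

Lemma height_nil : height [::] = 0.
Proof. by rewrite /height big_nil. Qed.

Lemma width_cons v L : width (v :: L) = v.1 + width L.
Proof. by rewrite /width big_cons. Qed.

Lemma height_cons v L : height (v :: L) = v.2 + height L.
Proof. by rewrite /height big_cons. Qed.

Lemma convex_path_cons v L :
  convex_path (v :: L) = [&& primitive v, all (steeper v) L & convex_path L].
Proof.
rewrite /convex_path /=.
by case: (primitive v); case: (all (steeper v) L); case: (all primitive L).
Qed.

Lemma above_start L : all primitive L -> above L 0 (height L).
Proof.
by case: L => // v L /= /andP[/and3P[v1 _ _] _]; rewrite v1 height_cons muln0.
Qed.

Lemma above_up L x y x' y' :
  all primitive L -> x <= x' -> y <= y' -> above L x y -> above L x' y'.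
Proof.
elim: L x y x' y' => // v L IH x y x' y' /= /andP[/and3P[v1 v2 _] pL] xx yy.
have [xv|xv] := ltnP x v.1; have [xv'|xv'] := ltnP x' v.1.
- by move=> h; apply: leq_trans h _; nia.
- move=> h; apply: (IH 0 (height L)); rewrite ?above_start //; nia.
- by lia.
- by apply: IH => //; lia.
Qed.

(** A line steeper than all the steps of L supports the region above L when it goes
through the starting point of the path. *)
Lemma above_supporting v L x y :
  all primitive L -> all (steeper v) L -> above L x y ->
  v.1 * height L <= v.2 * x + v.1 * y.
Proof.
elim: L x y => [|w L IH] x y /=; first by rewrite /height big_nil muln0.
move=> /andP[/and3P[w1 w2 _] pL] /andP[vw vL]; rewrite height_cons.
rewrite /steeper in vw; case: ltnP => xw; last by move=> /(IH _ _ pL vL); nia.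
move=> h; rewrite -(leq_pmul2l w1); nia.
Qed.

(** Moving up and to the left along a direction steeper than all the steps does not
leave the region above the path; this is the form of convexity that lets a
steeper step be put in front of a path. *)
Lemma above_shift v L x y d e :
  convex_path L -> primitive v -> all (steeper v) L -> d <= x ->
  v.2 * d <= v.1 * e -> above L x y -> above L (x - d) (y + e).
Proof.
move=> + /and3P[v1 v2 _].
elim: L x y => // w L IH x y; rewrite convex_path_cons /= => /and3P[pw wL cL].
case/andP: (cL) => pL _.
case/andP=> vw vL dx de.
have {}vw : w.2 * d <= w.1 * e.
  by rewrite /steeper in vw; rewrite -(leq_pmul2l v1); nia.
have [xw|xw] := ltnP x w.1.
  have -> : x - d < w.1 by lia.
  nia.
case: ltnP => xdw.
  move/(above_supporting pL wL); nia.
have -> : x - d - w.1 = x - w.1 - d by lia.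
by apply: IH => //; lia.
Qed.

(** By convexity, a point above the step v plus a point above L is above v :: L: in
the columns of v the line of v supports the region above L, and in the other
columns the part of v can be slid along v. *)
Lemma above_add v L x1 y1 x2 y2 :
  convex_path (v :: L) -> v.1 * v.2 <= v.2 * x1 + v.1 * y1 ->
  above L x2 y2 -> above (v :: L) (x1 + x2) (y1 + y2).
Proof.
rewrite convex_path_cons => /and3P[pv vL cL] h1 h2 /=.
case/andP: (cL) => pL _.
case: ltnP => xv; first by have := above_supporting pL vL h2; nia.
have [xv1|xv1] := leqP v.1 x1; first by apply: above_up h2 => //; lia.
have -> : x1 + x2 - v.1 = x2 - (v.1 - x1) by lia.
by rewrite addnC; apply: (above_shift cL pv vL) => //; nia.
Qed.

(** * Minkowski sums of steps *)

(** The sum of the regions of the single steps, without reference to their order. It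
is the whole quadrant for the empty list. *)
Fixpoint msum L x y : Prop :=
  if L is v :: L' then
    exists x1 y1 x2 y2, [/\ x = x1 + x2, y = y1 + y2,
      v.1 * v.2 <= v.2 * x1 + v.1 * y1 & msum L' x2 y2]
  else True.

(** A point in a column of the step v is a point of the region of v plus the starting
point of the rest of the path; a point further right is the end point (v.1, 0)
plus a point above the rest. Only lattice points occur, so the lattice points of
the Minkowski sum are sums of lattice points. This is why the product of two
complete monomial ideals in two variables is again complete. *)
Lemma above_msum L x y : all primitive L -> above L x y -> msum L x y.
Proof.
elim: L x y => // v L IH x y /= /andP[/and3P[v1 v2 _] pL].
case: ltnP => xv h.
  exists x, (y - height L), 0, (height L).
  split; rewrite ?addn0 //; last exact/IH/above_start.
  - by rewrite subnK //; nia.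
  - nia.
exists v.1, 0, (x - v.1), y; split => //; [lia|nia|exact: IH].
Qed.

Lemma msumP L x y : convex_path L -> reflect (msum L x y) (above L x y).
Proof.
move=> cL; apply: (iffP idP); first by apply: above_msum; case/andP: cL.
elim: L cL x y => // v L IH cL x y /= [x1 [y1 [x2 [y2 [-> -> h]]]]].
have cL' : convex_path L by move: cL; rewrite convex_path_cons => /and3P[].
by move/(IH cL')/(above_add cL h).
Qed.

Lemma msum_cat L1 L2 x y : msum (L1 ++ L2) x y <->
  exists x1 y1 x2 y2, [/\ x = x1 + x2, y = y1 + y2, msum L1 x1 y1 & msum L2 x2 y2].
Proof.
elim: L1 x y => [|v L1 IH] x y /=.
  split; first by move=> h; exists 0, 0, x, y.
  case=> x1 [y1 [x2 [y2 [-> -> _]]]].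
  elim: L2 x2 y2 => // v L2 IH x2 y2 /= [a [b [c [d [-> -> h /IH h2]]]]].
  by exists a, b, (x1 + c), (y1 + d); split => //; lia.
split.
- case=> x1 [y1 [x2 [y2 [-> -> h /IH[x3 [y3 [x4 [y4 [-> -> h3 h4]]]]]]]]].
  exists (x1 + x3), (y1 + y3), x4, y4; split => //; try lia.
  by exists x1, y1, x3, y3.
- case=> x1 [y1 [x2 [y2 [-> -> [x3 [y3 [x4 [y4 [-> -> h3 h4]]]]] h2]]]].
  exists x3, y3, (x4 + x2), (y4 + y2); split => //; try lia.
  by apply/IH; exists x4, y4, x2, y2.
Qed.

Lemma msum_catC L1 L2 x y : msum (L1 ++ L2) x y -> msum (L2 ++ L1) x y.
Proof.
move/msum_cat=> [x1 [y1 [x2 [y2 [-> -> h1 h2]]]]].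
by apply/msum_cat; exists x2, y2, x1, y1; split; rewrite // addnC.
Qed.

Lemma msum_perm L1 L2 x y : perm_eq L1 L2 -> msum L1 x y -> msum L2 x y.
Proof.
elim: L1 L2 x y => [|v L1 IH] L2 x y; first by rewrite perm_sym => /perm_nilP ->.
rewrite perm_sym => /perm_consP[i [u [Lu]]]; rewrite perm_sym => L1u.
move=> /= [x1 [y1 [x2 [y2 [-> -> h /(IH _ _ _ L1u) h2]]]]].
rewrite -(cat_take_drop i L2); apply: msum_catC.
by rewrite -/(rot i L2) Lu /=; exists x1, y1, x2, y2.
Qed.

(** * Counting the lattice points below a path *)

(** For two steps v and w, the term is the amount by which the area below the path of
both exceeds the areas below v and below w, so that mixed L L is twice the area
below the sorted path of L. It does not depend on the order of the steps and is
bilinear for concatenation. *)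
Definition mixed L1 L2 :=
  \sum_(v <- L1) \sum_(w <- L2) minn (v.1 * w.2) (w.1 * v.2).

Definition ceil_div n d := (n + d.-1) %/ d.

Lemma ceil_div_le n d y : 0 < d -> (ceil_div n d <= y) = (n <= d * y).
Proof.
move=> d0; rewrite /ceil_div leqNgt leq_divRL // -ltnNge.
by apply/idP/idP; nia.
Qed.

(** The number of lattice points below a single primitive step. As p does not divide
q t for 0 < t < p, the heights of the columns t and p - t add up to q + 1. *)
Lemma ceil_div_sum v : primitive v ->
  2 * (\sum_(1 <= t < v.1.+1) ceil_div (v.2 * t) v.1) + 1 = v.1 * v.2 + v.1 + v.2.
Proof.
case: v => p q /and3P[/= p0 q0 co].
have ceil_pair t : 0 < t < p -> ceil_div (q * t) p + ceil_div (q * (p - t)) p = q + 1.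
  move=> tp; have ndvd : ~~ (p %| q * t).
    by rewrite Gauss_dvdr // gtnNdvd //; lia.
  rewrite /ceil_div.
  have [r0 rp] : 0 < (q * t) %% p /\ (q * t) %% p < p.
    by rewrite lt0n ltn_mod.
  have qp : (q * t) %/ p < q by rewrite ltn_divLR //; nia.
  have := divn_eq (q * t) p.
  move: ((q * t) %/ p) ((q * t) %% p) r0 rp qp => k r r0 rp qp e.
  have e1 : q * t + p.-1 = k.+1 * p + r.-1 by rewrite e; nia.
  have e2 : q * (p - t) + p.-1 = (q - k) * p + (p.-1 - r).
    by rewrite mulnBr e; nia.
  by rewrite e1 e2 !divnMDl // !divn_small; lia.
rewrite big_nat_recr //=.
have -> : ceil_div (q * p) p = q.
  by rewrite /ceil_div divnMDl // divn_small; lia.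
have : \sum_(1 <= t < p) ceil_div (q * t) p + \sum_(1 <= t < p) ceil_div (q * t) p
   = p.-1 * (q + 1).
  rewrite [X in _ + X]big_nat_rev /= -big_split /=.
  rewrite (eq_big_nat _ _ (F2 := fun=> q + 1)) ?sum_nat_const_nat ?subn1 //.
move: (\sum_(_ <= _ < _) _) => S; nia.
Qed.

Fixpoint below L : seq (nat * nat) :=
  if L is v :: L' then
    [seq (x, y) | x <- iota 0 v.1,
       y <- iota 0 (height L' + ceil_div (v.2 * (v.1 - x)) v.1)]
    ++ [seq (u.1 + v.1, u.2) | u <- below L']
  else [::].

Lemma mem_below L x y : all primitive L -> ((x, y) \in below L) = ~~ above L x y.
Proof.
elim: L x => // v L IH x /= /andP[/and3P[v1 v2 _] pL].
rewrite mem_cat; case: ltnP => xv.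
  have -> : ((x, y) \in [seq (u.1 + v.1, u.2) | u <- below L]) = false.
    by apply/mapP => -[[a b] _ [/= e _]]; lia.
  rewrite orbF; have := ceil_div_le (v.2 * (v.1 - x)) (y - height L) v1.
  set c := ceil_div _ _ => hc.
  have -> : ((x, y) \in [seq (x0, y0) | x0 <- iota 0 v.1,
       y0 <- iota 0 (height L + ceil_div (v.2 * (v.1 - x0)) v.1)]) = (y < height L + c).
    apply/allpairsPdep/idP => [[a [b [_ + [e1 e2]]]]|h].
      by rewrite mem_iota -e1 -e2 -/c.
    by exists x, y; rewrite !mem_iota; split.
  rewrite ltnNge; congr negb.
  apply/idP/idP => [h|h].
    have : c <= y - height L by lia.
    by rewrite hc; nia.
  have hy : height L <= y by nia.
  have : c <= y - height L by rewrite hc; nia.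
  lia.
rewrite -IH //.
have -> : ((x, y) \in [seq (x0, y0) | x0 <- iota 0 v.1,
       y0 <- iota 0 (height L + ceil_div (v.2 * (v.1 - x0)) v.1)]) = false.
  by apply/allpairsPdep => [[a [b [+ _ [e _]]]]]; rewrite mem_iota; lia.
apply/mapP/idP => [[[a b] h [-> ->]]|h]; first by rewrite /= addnK.
by exists (x - v.1, y) => //=; rewrite subnK.
Qed.

Lemma below_uniq L : uniq (below L).
Proof.
elim: L => //= v L IH; rewrite cat_uniq; apply/and3P; split.
- apply: allpairs_uniq_dep; rewrite ?iota_uniq //.
    by move=> x _; exact: iota_uniq.
  by move=> [a b] [c d] _ _ /= [-> ->].
- apply/hasPn => -[a b] /mapP[[c d] _ [-> ->]] /=.
  by apply/allpairsPdep => -[e [f [+ _ [g _]]]]; rewrite mem_iota; lia.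
- by rewrite map_inj_uniq // => -[a b] [c d] /= [/addIn -> ->].
Qed.

(** When v is steeper than every step w of L, the minimum for (v, w) is v.1 * w.2,
and their sum is the area of the rectangle below v and beside the rest. *)
Lemma mixed_cons v L : all (steeper v) L ->
  mixed (v :: L) (v :: L) = mixed L L + v.1 * v.2 + 2 * (v.1 * height L).
Proof.
move=> vL; rewrite /mixed !big_cons minnn.
under [X in _ + X = _]eq_bigr do rewrite big_cons.
rewrite big_split /= /height big_distrr /=.
have e1 : \sum_(w <- L) minn (v.1 * w.2) (w.1 * v.2) = \sum_(w <- L) v.1 * w.2.
  by apply: eq_big_seq => w /(allP vL); rewrite /steeper => h; apply/minn_idPl; lia.
have e2 : \sum_(w <- L) minn (w.1 * v.2) (v.1 * w.2) = \sum_(w <- L) v.1 * w.2.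
  by rewrite -e1; apply: eq_bigr => w _; rewrite minnC.
rewrite e1 e2; lia.
Qed.

(** Pick's theorem for the region below a convex path, counted column by column. *)
Lemma below_size L : convex_path L ->
  2 * size (below L) + size L = mixed L L + width L + height L.
Proof.
elim: L => [|v L IH]; first by rewrite /mixed /width /height !big_nil.
rewrite convex_path_cons => /and3P[pv vL cL].
rewrite mixed_cons // width_cons height_cons /= size_cat size_map.
rewrite size_allpairs_dep; have := IH cL; have := ceil_div_sum pv.
set S := sumn _; have -> : S = v.1 * height L +
    \sum_(1 <= t < v.1.+1) ceil_div (v.2 * t) v.1.
  rewrite /S; transitivity (\sum_(0 <= x < v.1)
      (height L + ceil_div (v.2 * (v.1 - x)) v.1)).
    rewrite sumnE big_map /index_iota subn0.
    by apply: eq_bigr => x _; rewrite size_iota.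
  rewrite big_split /= sum_nat_const_nat subn0; congr (_ + _).
  rewrite big_add1 /= big_nat_rev /=.
  apply: eq_big_nat => x xv; congr (ceil_div (_ * _) _); lia.
lia.
Qed.

Lemma mixed_catl L1 L2 L : mixed (L1 ++ L2) L = mixed L1 L + mixed L2 L.
Proof. by rewrite /mixed big_cat. Qed.

Lemma mixedC L1 L2 : mixed L1 L2 = mixed L2 L1.
Proof.
rewrite /mixed exchange_big /=; apply: eq_bigr => v _; apply: eq_bigr => w _.
exact: minnC.
Qed.

Lemma mixed_perm L1 L2 : perm_eq L1 L2 -> mixed L1 L1 = mixed L2 L2.
Proof.
move=> p; rewrite /mixed (perm_big _ p) /=.
by apply: eq_bigr => v _; rewrite (perm_big _ p).
Qed.

Lemma convex_path_sort L : all primitive L -> convex_path (sort steeper L).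
Proof.
move=> pL; rewrite /convex_path all_sort pL /=.
have tr : {in primitive & &, transitive steeper}.
  move=> v u w /and3P[v1 v2 _] /and3P[u1 u2 _] /and3P[w1 w2 _].
  by rewrite /steeper => h1 h2; rewrite -(leq_pmul2l v1); nia.
rewrite -(sorted_pairwise_in tr) ?all_sort //.
by apply: (sort_sorted_in (P := primitive)) => // v w _ _; rewrite /steeper; lia.
Qed.

End LatticePaths.

(** * The path of an integrally closed set of exponents *)

Section NewtonPathExists.
Local Open Scope nat_scope.

(** Closure under convex combinations of two points and under moving up or right,
with the denominator of the combination cleared: this is what integral
closedness of an ideal says about its set of exponents. *)
Definition lattice_convex (E : nat -> nat -> bool) :=
  forall i j x1 y1 x2 y2 x y, 0 < i + j -> E x1 y1 -> E x2 y2 ->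
    i * x1 + j * x2 <= (i + j) * x -> i * y1 + j * y2 <= (i + j) * y -> E x y.

Lemma lattice_convex_up E x y x' y' : lattice_convex E ->
  x <= x' -> y <= y' -> E x y -> E x' y'.
Proof.
by move=> cE xx yy h; apply: (cE 1 0 _ _ _ _ _ _ _ h h) => //; lia.
Qed.

Lemma lattice_convex_shift E p : lattice_convex E ->
  lattice_convex (fun x y => E (x + p) y).
Proof.
move=> cE i j x1 y1 x2 y2 x y ij h1 h2 hx hy.
by apply: (cE i j _ _ _ _ _ _ ij h1 h2) => //; nia.
Qed.

(** This finds the edge of the Newton boundary that starts at (0, b). The rows below b
are added one at a time, and in each of them only the leftmost point of E matters. *)
Lemma steepest_slope E a b n : lattice_convex E -> E a 0 ->
  (forall y, E 0 y -> b <= y) -> 0 < n <= b ->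
  exists p q, [/\ 0 < p, 0 < q <= n, E p (b - q) &
    forall x d, 0 < d <= n -> E x (b - d) -> d * p <= q * x].
Proof.
move=> cE Ea minb; elim: n => // n IH nb.
have ex : exists x, E x (b - n.+1).
  by exists a; apply: (lattice_convex_up cE _ _ Ea) => //; lia.
case: (ex_minnP ex) => x0 Ex0 minx0.
have x0_gt0 : 0 < x0.
  by rewrite lt0n; apply/eqP => x00; move: Ex0; rewrite x00 => /minb; lia.
have [n0|n0] := posnP n.
  exists x0, n.+1; split; rewrite ?leqnn // => x d dn.
  have -> : d = n.+1 by lia.
  by move/minx0; nia.
have [|p [q [p0 qn Epq maxq]]] := IH; first by lia.
have [h|h] := leqP (n.+1 * p) (q * x0).
  exists p, q; split=> //; first by lia.
  move=> x d dn Ed; have [dn'|e] : d <= n \/ d = n.+1 by lia.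
    by apply: maxq => //; lia.
  by move: Ed; rewrite e => /minx0; nia.
exists x0, n.+1; split; rewrite ?leqnn // => x d dn Ed.
have [dn'|e] : d <= n \/ d = n.+1 by lia.
  have : d * p <= q * x by apply: maxq => //; lia.
  by move=> dp; rewrite -(leq_pmul2r p0); nia.
by move: Ed; rewrite e => /minx0; nia.
Qed.

(** Dividing the steepest edge vector by the gcd of its coordinates gives a primitive
step, which still ends in E because E contains the lattice points of the edge. *)
Lemma first_step E a b : lattice_convex E -> E a 0 -> E 0 b ->
  (forall y, E 0 y -> b <= y) -> 0 < b ->
  exists v, [/\ primitive v, v.2 <= b, E v.1 (b - v.2) &
    forall x y, E x y -> v.1 * b <= v.2 * x + v.1 * y].
Proof.
move=> cE Ea Eb minb b0.
have [|p [q [p0 qb Epq maxq]]] := @steepest_slope E a b b cE Ea minb; first by lia.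
have g0 : 0 < gcdn p q by rewrite gcdn_gt0 p0.
have [p' ep] := dvdnP (dvdn_gcdl p q); have [q' eq] := dvdnP (dvdn_gcdr p q).
move eg : (gcdn p q) g0 ep eq => g g0 ep eq.
have p'0 : 0 < p' by nia.
have q'0 : 0 < q' by nia.
have q'q : q' <= q by nia.
exists (p', q'); split => /=.
- rewrite /primitive /= p'0 q'0 /coprime /=.
  by rewrite -(eqn_pmul2r g0) mul1n muln_gcdl -ep -eq eg.
- lia.
- apply: (cE 1 (g - 1) _ _ _ _ _ _ _ Epq Eb); nia.
- move=> x y Exy; have [yb|yb] := leqP b y; first by nia.
  have : (b - y) * p <= q * x.
    by apply: maxq; [lia | rewrite subKn // ltnW].
  rewrite ep eq => h.
  have : (b - y) * p' <= q' * x by rewrite -(leq_pmul2r g0); nia.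
  nia.
Qed.

(** Gift wrapping: after the first step, the part of E to the right of it is again
lattice convex, with a smaller starting height. In the columns of the first step,
E is bounded below by the step since it is steepest, and contains everything above
the step since E contains both of its ends. *)
Lemma lattice_convex_path E a b : lattice_convex E -> E a 0 -> E 0 b ->
  (forall y, E 0 y -> b <= y) ->
  exists L, [/\ convex_path L, height L = b & forall x y, E x y = above L x y].
Proof.
elim/ltn_ind: b E a => b IH E a cE Ea Eb minb.
have [b0|b0] := posnP b.
  exists [::]; split => //; first by rewrite /height big_nil.
  by move=> x y; apply: (lattice_convex_up cE _ _ Eb) => //; rewrite b0.
have [[p q] [/= pv qb Ev maxv]] := first_step cE Ea Eb minb b0.
have /and3P[/= p0 q0 _] := pv.
have [|||||L [cL hL eL]] := IH (b - q) _ (fun x y => E (x + p) y) a.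
- lia.
- exact: lattice_convex_shift.
- by apply: (lattice_convex_up cE _ _ Ea) => //; lia.
- by rewrite add0n.
- by move=> y; rewrite add0n => /maxv; nia.
exists ((p, q) :: L); split.
- rewrite convex_path_cons pv cL andbT /=; case/andP: (cL) => pL pwL.
  apply/allP => w wL; rewrite /steeper /=.
  case: L cL hL eL pL pwL wL => // u L cL hL eL /= /andP[/and3P[u1 u2 _] pL].
  move=> /andP[uL _] wuL.
  have : E (u.1 + p) (height L).
    by rewrite eL /= ltnn subnn above_start.
  move/maxv => h; have {}h : u.2 * p <= q * u.1.
    by rewrite height_cons in hL; nia.
  move: wuL; rewrite inE => /predU1P[->|/(allP uL)]; first by [].
  by rewrite /steeper => uw; rewrite -(leq_pmul2l u1); nia.
- by rewrite height_cons hL /= subnKC.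
- move=> x y /=; rewrite hL subnKC //; case: ltnP => xp.
    apply/idP/idP => [/maxv//|h].
    have px := subnK (ltnW xp).
    apply: (cE (p - x) x _ _ _ _ _ _ _ Eb Ev); rewrite px //; first by nia.
    have : x * (b - q) + q * x = x * b by rewrite mulnBr; nia.
    have : (p - x) * b + x * b = p * b by rewrite -mulnDl px.
    by lia.
  by rewrite -eL subnK.
Qed.
End NewtonPathExists.

(** * Monomial ideals and their products *)

(** Membership in a span quantifies over submodules; the submodule used here is the
set of elements that satisfy P. *)
Lemma span_elim (A : pzRingType) (M : lmodType A) (G : set M) (P : M -> Prop) :
  P 0 -> (forall a u v, P u -> P v -> P (a *: u + v)) ->
  (forall x, G x -> P x) -> forall x, x \in Defs.span G -> P x.
Proof.
move=> P0 PD PG x /asboolP.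
pose Q : M -> bool := fun x => `[< P x >].
have Qcl : GRing.submod_closed Q.
  split; first exact/asboolP.
  by move=> a u v /asboolP uP /asboolP vP; apply/asboolP/PD.
pose N : submodClosed M := HB.pack Q (GRing.isSubmodClosed.Build A M Q Qcl).
by move=> /(_ N) h; apply/asboolP; apply: h => y /PG yP; apply/asboolP.
Qed.

Lemma mem_span (A : pzRingType) (M : lmodType A) (G : set M) x :
  G x -> x \in Defs.span G.
Proof. by move=> Gx; apply/asboolP => N; apply. Qed.

Section MonomialIdeals.
Variable k : fieldType.

Notation poly2 := (mpoly 2 k).
Notation xdeg u := (fun_of_multinom u (@ord0 1)).
Notation ydeg u := (fun_of_multinom u (@ord_max 1)).

Implicit Types (K : ideal poly2) (u w : multinom 2) (p : poly2).

Definition mono (x y : nat) : multinom 2 := Multinom [tuple x; y].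

Lemma xdeg_mono x y : xdeg (mono x y) = x. Proof. by []. Qed.
Lemma ydeg_mono x y : ydeg (mono x y) = y. Proof. by []. Qed.

Lemma monoE u : u = mono (xdeg u) (ydeg u).
Proof.
apply/mnmP => i; case: (unliftP ord0 i) => [j|] ->; last by [].
by rewrite (ord1 j) (_ : lift _ _ = ord_max) //; apply/val_inj.
Qed.

Lemma monoD x y x' y' : mnm_add (mono x y) (mono x' y') = mono (x + x') (y + y').
Proof. by rewrite [LHS]monoE !mnmDE. Qed.

Lemma ideal_scale K a p : p \in K -> a * p \in K.
Proof.
move=> pK; change ((a : poly2) *: (p : poly2^o) \in K); exact: rpredZ.
Qed.

Lemma mem_ideal_mul K1 K2 p q : p \in K1 -> q \in K2 -> p * q \in ideal_mul K1 K2.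
Proof. by move=> pK qK; apply: mem_span; exists p => //; exists q. Qed.

Lemma ideal_of_support K p :
  (forall u, u \in msupp p -> mpolyX k u \in K) -> p \in K.
Proof.
move=> h; rewrite (mpolyE p) big_seq; apply: rpred_sum => u /h uK.
by rewrite -mul_mpolyC ideal_scale.
Qed.

Definition supported (F : multinom 2 -> Prop) p :=
  forall u, u \in msupp p -> F u.

Lemma supported_comb (F : multinom 2 -> Prop) :
  (forall u w, F w -> F (mnm_add u w)) ->
  forall a p q, supported F p -> supported F q -> supported F (a * p + q).
Proof.
move=> Fup a p q pF qF u /msuppD_le; rewrite mem_cat => /orP[|/qF//].
move/msuppM_le => /allpairsP[[u1 u2] /= [_ /pF u2F ->]]; exact: Fup.
Qed.

Lemma monomial_ideal_support K : monomial_ideal K ->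
  forall p u, p \in K -> u \in msupp p -> mpolyX k u \in K.
Proof.
move=> [S KS] p u pK up.
have KE q : (q \in K) = (q \in ideal_gen (mpolyX k @` S)%classic).
  apply/idP/idP => h.
    by have : [set` K]%classic q by []; rewrite KS.
  by have : [set` ideal_gen (mpolyX k @` S)%classic]%classic q by []; rewrite -KS.
have : supported (fun u => exists w s, u = mnm_add w s /\ S s) p.
  move: pK; rewrite KE; apply: span_elim => [w||].
  - by rewrite msupp0.
  - apply: supported_comb => u1 u2 [w [s [-> Ss]]].
    by exists (mnm_add u1 w), s; rewrite addmA.
  - move=> _ [s Ss <-] w; rewrite msuppX inE => /eqP->.
    by exists (@mnm0 2), s; rewrite add0m.
move=> /(_ u up) [w [s [-> Ss]]]; rewrite mpolyXD ideal_scale //.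
by rewrite KE; apply: mem_span; exists s.
Qed.

(** Stated with supports rather than generators, because products and quotients of
monomial ideals are computed monomial by monomial. *)
Definition has_path K L := forall p, p \in K <->
  supported (fun u => msum L (xdeg u) (ydeg u)) p.

Lemma msum_up L x y x' y' : msum L x y -> msum L (x' + x) (y' + y).
Proof.
by move=> h; rewrite -[L]cat0s; apply/msum_cat; exists x', y', x, y.
Qed.

Lemma has_path_mono K L x y : has_path K L ->
  (mpolyX k (mono x y) \in K) <-> msum L x y.
Proof.
move=> KL; rewrite KL /supported msuppX; split.
  by move/(_ (mono x y)); rewrite inE eqxx => /(_ isT).
by move=> h u; rewrite inE => /eqP->.
Qed.

Lemma has_path_mul K1 K2 L1 L2 : has_path K1 L1 -> has_path K2 L2 ->
  has_path (ideal_mul K1 K2) (L1 ++ L2).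
Proof.
move=> h1 h2 p; split.
  apply: span_elim => [u||].
  - by rewrite msupp0.
  - by apply: supported_comb => u w; rewrite !mnmDE; exact: msum_up.
  - move=> _ [a /h1 aK [b /h2 bK <-]] u /msuppM_le /allpairsP[[u1 u2] /=].
    move=> [/aK m1 /bK m2 ->]; rewrite !mnmDE; apply/msum_cat.
    by do 4 eexists; split; [reflexivity|reflexivity|exact: m1|exact: m2].
move=> sp; apply: ideal_of_support => u /sp /msum_cat.
move=> [x1 [y1 [x2 [y2 [ex ey m1 m2]]]]].
rewrite (monoE u) ex ey -monoD mpolyXD.
by apply: mem_ideal_mul; [apply/(has_path_mono _ _ h1)|apply/(has_path_mono _ _ h2)].
Qed.

Lemma has_path_exp K L m : has_path K L ->
  has_path (ideal_exp K m) (flatten (nseq m L)).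
Proof.
move=> KL; elim: m => [|m IH]; last exact: has_path_mul.
by move=> p; split=> // _; apply: mem_span.
Qed.

Lemma ideal_exp_mono K x y m : mpolyX k (mono x y) \in K ->
  mpolyX k (mono (m * x) (m * y)) \in ideal_exp K m.
Proof.
move=> h; elim: m => [|m IH]; first exact: mem_span.
by rewrite !mulSn -monoD mpolyXD; apply: mem_ideal_mul.
Qed.

(** The product of i factors with the first exponent and j factors with the second
one divides the monomial. *)
Lemma ideal_expD_mono K i j x1 y1 x2 y2 x y :
  mpolyX k (mono x1 y1) \in K -> mpolyX k (mono x2 y2) \in K ->
  (i * x1 + j * x2 <= x)%N -> (i * y1 + j * y2 <= y)%N ->
  mpolyX k (mono x y) \in ideal_exp K (i + j).
Proof.
move=> h1 h2 hx hy.
rewrite -(subnK hx) -(subnK hy) -monoD mpolyXD; apply: ideal_scale.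
elim: i {hx hy} => [|i IH]; first exact: ideal_exp_mono.
by rewrite addSn !mulSn -!addnA -monoD mpolyXD; apply: mem_ideal_mul.
Qed.

(** If the exponent of X is a convex combination with denominator i + j of two
exponents of K, then X ^+ (i + j) lies in the power i + j of K, and
T ^+ (i + j) - X ^+ (i + j) is an equation of integral dependence for X. *)
Lemma complete_lattice_convex K : complete K ->
  lattice_convex (fun x y => mpolyX k (mono x y) \in K).
Proof.
move=> cK i j x1 y1 x2 y2 x y ij h1 h2 hx hy.
set X := mpolyX k _; suff : [set` K]%classic X by [].
rewrite cK; exists (i + j)%N, (fun l => - (X ^+ l) *+ (l == i + j)%N); split => //.
  move=> l _; case: eqP => [->|_]; last exact: rpred0.
  rewrite mulr1n -mulN1r; apply: ideal_scale; rewrite mpolyXn.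
  rewrite (monoE (mnm_muln _ _)) !mulmnE xdeg_mono ydeg_mono.
  by apply: (ideal_expD_mono h1 h2); rewrite [leqRHS]mulnC.
rewrite big_nat_recr /=; last by lia.
rewrite big_nat big1 => [|l lij]; last first.
  by rewrite (_ : (l == i + j)%N = false) ?mulr0n ?mul0r //; apply/eqP; lia.
by rewrite eqxx mulr1n subnn expr0 mulr1 add0r subrr.
Qed.

(** The radical condition provides pure powers of both variables in K, hence the end
points that the path needs on the axes. *)
Lemma complete_has_path K : primary_to (max_ideal k) K -> monomial_ideal K ->
  complete K -> exists2 L, convex_path L & has_path K L.
Proof.
move=> [_ radK] monK cK; have convK := complete_lattice_convex cK.
have rad (i : 'I_2) : exists n, mpolyX k (mnm1 i) ^+ n \in K.
  have : radical K (mpolyX k (mnm1 i)).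
    rewrite radK; apply: mem_span.
    by case: (unliftP ord0 i) => [j|] ->; [right|left] => //;
      rewrite (ord1 j); congr (mpolyX k (mnm1 _)); apply/val_inj.
  by [].
have [a Ka] := rad ord0; have [b Kb] := rad ord_max.
have {}Ka : mpolyX k (mono a 0) \in K.
  move: Ka; rewrite mpolyXn (_ : mnm_muln _ _ = mono a 0) //.
  by rewrite (monoE (mnm_muln _ _)) !mulmnE !mnm1E mul1n mul0n.
have {}Kb : mpolyX k (mono 0 b) \in K.
  move: Kb; rewrite mpolyXn (_ : mnm_muln _ _ = mono 0 b) //.
  by rewrite (monoE (mnm_muln _ _)) !mulmnE !mnm1E mul1n mul0n.
have exb : exists y, mpolyX k (mono 0 y) \in K by exists b.
case: (ex_minnP exb) => b' Kb' minb'.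
have [L [cL _ eL]] := lattice_convex_path convK Ka Kb' minb'.
exists L => // p; split.
  move=> pK u up; apply/msumP => //; rewrite -eL -monoE.
  exact: (monomial_ideal_support monK pK).
move=> sp; apply: ideal_of_support => u /sp /(msumP _ _ cL).
by rewrite -eL -monoE.
Qed.

End MonomialIdeals.

(** * Length of the quotient by a monomial ideal *)

Section QuotientLength.
Local Open Scope quotient_scope.

Section Submodules.
Variables (A : pzRingType) (M : lmodType A) (N : submodClosed M).
Implicit Types (W : submodClosed M) (x : M).

Lemma quot_eqP x y :
  reflect (\pi_(quot_mod N) x = \pi_(quot_mod N) y) (x - y \in N).
Proof.
have -> : (x - y \in N) = (x - y \in submod_zmod N) by [].
rewrite (@Quotient.idealrBE _ (submod_zmod N)) /quot_mod.
by apply: (iffP (@eqP _ _ _)).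
Qed.

Lemma repr_pi_sub x : repr (\pi_(quot_mod N) x) - x \in N.
Proof. by apply/quot_eqP; rewrite reprK. Qed.

Lemma pi_quot0 : \pi_(quot_mod N) 0 = 0.
Proof. by apply: (addrI (\pi_(quot_mod N) 0)); rewrite addr0 -pi_quot_add addr0. Qed.

Lemma quot_submod W : {subset N <= W} ->
  exists Q : submodClosed (quot_mod N), forall x, (\pi_(quot_mod N) x \in Q) = (x \in W).
Proof.
move=> NW; pose Q : quot_mod N -> bool := fun q => repr q \in W.
have QE x : Q (\pi_(quot_mod N) x) = (x \in W).
  have h := NW _ (repr_pi_sub x); rewrite /Q; apply/idP/idP => xW.
    rewrite -(subKr (repr (\pi_(quot_mod N) x)) x).
    by rewrite rpredD // -scaleN1r rpredZ.
  by rewrite -[X in X \in W](subrK x) rpredD.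
have Qcl : GRing.submod_closed Q.
  split=> [|a u v].
    by rewrite /in_mem /= -pi_quot0 QE rpred0.
  rewrite /in_mem /= -[u]reprK -[v]reprK !QE => uW vW.
  rewrite [_ *: _]pi_quot_scale -pi_quot_add QE.
  by rewrite rpredD // rpredZ.
pose W' : submodClosed (quot_mod N) :=
  HB.pack Q (GRing.isSubmodClosed.Build A (quot_mod N) Q Qcl).
by exists W'; exact: QE.
Qed.

Lemma preim_submod (Q : submodClosed (quot_mod N)) :
  exists W, forall x, (x \in W) = (\pi_(quot_mod N) x \in Q).
Proof.
pose P : M -> bool := fun x => \pi_(quot_mod N) x \in Q.
have Pcl : GRing.submod_closed P.
  split=> [|a u v]; first by rewrite /in_mem /= /P pi_quot0 rpred0.
  rewrite /in_mem /= /P => uQ vQ.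
  by rewrite pi_quot_add -pi_quot_scale rpredD //; exact: rpredZ.
pose W : submodClosed M := HB.pack P (GRing.isSubmodClosed.Build A M P Pcl).
by exists W.
Qed.

(** A chain of submodules between N and M descends to the quotient. *)
Lemma length_ge (R : realType) (W : nat -> submodClosed M) n :
  (forall i, {subset N <= W i}) -> (forall i, {subset W i <= W i.+1}) ->
  (forall i, (i < n)%N -> exists2 x, x \in W i.+1 & x \notin W i) ->
  (n%:R%:E <= length R (quot_mod N))%E.
Proof.
move=> NW WW Wn; apply: ereal_sup_ubound; exists n => //.
have [Q QE] := choice (fun i => quot_submod (NW i)).
exists Q => i /Wn [x xW xnW]; split=> [q|].
  by rewrite /= -[q]reprK !QE; exact: WW.
by move=> /(_ (\pi_(quot_mod N) x)) /=; rewrite !QE xW (negPf xnW) => /(_ isT).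
Qed.

End Submodules.

Section MonomialLength.
Variables (R : realType) (k : fieldType).

Notation poly2 := (mpoly 2 k).
Notation xdeg u := (fun_of_multinom u (@ord0 1)).
Notation ydeg u := (fun_of_multinom u (@ord_max 1)).

Definition down_closed (D : seq (nat * nat)) := forall x y x' y',
  (x', y') \in D -> (x <= x')%N -> (y <= y')%N -> (x, y) \in D.

Definition avoids (D : seq (nat * nat)) (p : poly2) :=
  all (fun u => (xdeg u, ydeg u) \notin D) (msupp p).

(** Multiplying by a monomial cannot move an exponent from outside a down-closed set
into it. *)
Lemma avoids_submod D : down_closed D ->
  exists W : ideal poly2, forall p, (p \in W) = avoids D p.
Proof.
move=> dD; pose Q : poly2^o -> bool := avoids D.
have Qcl : GRing.submod_closed Q.
  split=> [|a p q]; first by rewrite /in_mem /= /Q /avoids msupp0.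
  move=> /allP pD /allP qD; apply/allP.
  apply: (@supported_comb _ (fun u => is_true ((xdeg u, ydeg u) \notin D)) _ a p q) => //.
  move=> u w; apply: contra; rewrite !mnmDE => h.
  by apply: (dD _ _ _ _ h); rewrite leq_addl.
pose W : ideal poly2 :=
  HB.pack Q (GRing.isSubmodClosed.Build poly2 poly2^o Q Qcl).
by exists W.
Qed.

Variables (K : ideal poly2) (C : seq (nat * nat)).
Hypothesis KC : forall p, (p \in K) = avoids C p.

(** Elements that witness the strict inclusions of a chain are linearly independent
over the field modulo K, and the quotient is spanned by the monomials of C. *)
Lemma length_monomial_le : (length R (quot_mod K) <= (size C)%:R%:E)%E.
Proof.
apply: ge_ereal_sup => _ [n [N chain] <-]; rewrite lee_fin ler_nat leqNgt.
apply/negP => nC.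
have mono_N d i : (d + i <= n)%N -> {subset N i <= N (d + i)%N}.
  elim: d => [|d IH] dn q qi; first by rewrite add0n.
  have qN := IH (ltnW dn) q qi.
  by have [h _] := chain (d + i)%N dn; exact: h.
have ex i : exists p, (i < n)%N ->
    \pi_(quot_mod K) p \in N i.+1 /\ \pi_(quot_mod K) p \notin N i.
  have [iN|] := ltnP i n; last by exists 0.
  have [_ /existsNP[q /not_implyP[q1 q2]]] := chain i iN.
  by exists (repr q) => _; rewrite reprK; split=> //; apply/negP.
have [f fP] := choice ex.
pose A : 'M[k]_(n, size C) := \matrix_(i, j)
  mcoeff (mono (nth (0,0)%N C j).1 (nth (0,0)%N C j).2) (f i).
have : kermx A != 0.
  rewrite kermx_eq0 /row_free neq_ltn (leq_ltn_trans _ nC) //.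
  exact: rank_leq_col.
case/rowV0Pn => v /sub_kermxP vA v0.
have {v0} [i vi maxi] : exists2 i : 'I_n, v 0 i != 0 & forall j : 'I_n, (i < j)%N -> v 0 j = 0.
  have [i0 vi0] : exists i, v 0 i != 0 by apply/rV0Pn.
  case: (@arg_maxnP _ i0 (fun i => v 0 i != 0) (fun i => i : nat) vi0) => i vi h.
  exists i => // j ij; apply/eqP/negPn/negP => /h ji; have : (j <= i)%N by []; lia.
have S0 : \sum_j (v 0 j) *: f j \in K.
  rewrite KC; apply/allP => u; rewrite mcoeff_msupp; apply: contra => uC'.
  have jC : (index (xdeg u, ydeg u) C < size C)%N by rewrite index_mem.
  have := congr1 (fun B : 'rV_ _ => B 0 (Ordinal jC)) vA; rewrite mxE mxE => <-.
  rewrite raddf_sum; apply/eqP/eq_bigr => j _.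
  by rewrite [LHS]mcoeffZ mxE /= nth_index // -monoE.
(* The last element with a nonzero coefficient lies in the previous member of the
   chain *)
have [W WE] := preim_submod (N i).
have KW : {subset K <= W}.
  move=> p pK; rewrite WE; have /quot_eqP -> : p - 0 \in K by rewrite subr0.
  by rewrite pi_quot0 rpred0.
have kW (c : k) (p : poly2) : p \in W -> c *: p \in W.
  by move=> pW; rewrite -mul_mpolyC; exact: ideal_scale.
have [_ /negP] := fP i (ltn_ord i); apply; rewrite -WE.
have -> : f i = (v 0 i)^-1 *: (v 0 i *: f i) by rewrite scalerA mulVf // scale1r.
apply: (kW).
have -> : v 0 i *: f i = \sum_j v 0 j *: f j + -1 * \sum_(j | j != i) v 0 j *: f j.
  by rewrite (bigD1 i) //= mulN1r addrK.
apply: rpredD; first exact: KW.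
apply: ideal_scale; apply: rpred_sum => j ji.
case: (ltngtP i j) => [/maxi ->|ij|ij]; last by rewrite (val_inj ij) eqxx in ji.
  by rewrite scale0r rpred0.
apply: (kW); rewrite WE; have [h _] := fP j (ltn_ord j).
by rewrite -(subnK ij); apply: mono_N h; rewrite subnK // ltnW.
Qed.

Hypotheses (dC : down_closed C) (uC : uniq C).

(** Adding the missing monomials one at a time, by decreasing degree, keeps every
intermediate set of monomials closed under multiplication. *)
Lemma length_monomial_ge : ((size C)%:R%:E <= length R (quot_mod K))%E.
Proof.
pose r (a b : nat * nat) := (b.1 + b.2 <= a.1 + a.2)%N.
have rT : transitive r by move=> a b c; rewrite /r; lia.
pose C' := sort r C.
have sC' : pairwise r C'.
  by rewrite -sorted_pairwise //; apply: sort_sorted => a b; rewrite /r; lia.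
have uC' : uniq C' by rewrite sort_uniq.
have mC' z : (z \in C') = (z \in C) by rewrite mem_sort.
have dD i : down_closed (drop i C').
  move=> x y x' y' h xx yy.
  have xC : (x, y) \in C' by rewrite mC'; apply: dC xx yy; rewrite -mC' (mem_drop h).
  move: xC; rewrite -[X in _ \in X](cat_take_drop i) mem_cat => /orP[xt|//].
  have := sC'; rewrite -{1}(cat_take_drop i C') pairwise_cat => /and3P[/allrelP /(_ _ _ xt h)].
  rewrite /r /= => hr _ _; have e : (x, y) = (x', y') by congr pair; lia.
  by rewrite e.
have [W WE] := choice (fun i => avoids_submod (dD i)).
rewrite -(size_sort r); apply: (@length_ge _ _ _ _ W).
- move=> i p; rewrite KC WE; apply: sub_all => u; apply: contra => h.
  by rewrite -mC'; exact: mem_drop h.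
- move=> i p; rewrite !WE; apply: sub_all => u; apply: contra => h.
  by rewrite -(add1n i) -drop_drop in h; exact: mem_drop h.
- move=> i; rewrite -/C' => iC; pose z := nth (0, 0)%N C' i.
  exists (mpolyX k (mono z.1 z.2)); rewrite WE /avoids msuppX /= andbT.
    rewrite -surjective_pairing.
    move: uC'; rewrite -[X in uniq X](cat_take_drop i) (drop_nth (0, 0)%N iC).
    by rewrite cat_uniq /= => /and3P[_ _ /andP[]].
  by rewrite negbK -surjective_pairing (drop_nth (0, 0)%N iC) mem_head.
Qed.

End MonomialLength.
End QuotientLength.

(** * The profile of a path *)

Section NewtonFunction.
Variable R : realType.
Implicit Types (v : step) (L : seq step) (x y s t : R).

Definition slope v : R := v.2%:R / v.1%:R.

(** The piecewise linear function whose graph is the path, continued by 0 to the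
right. As a maximum of affine functions it is visibly convex and continuous on
the whole line; for a sorted path the maximum picks the step over x
(profile_left, profile_right). *)
Fixpoint profile L x : R :=
  if L is v :: L' then
    Num.max ((v.2 + height L')%:R - slope v * x) (profile L' (x - v.1%:R))
  else 0.

Lemma slope_gt0 v : primitive v -> 0 < slope v.
Proof. by case/and3P=> v1 v2 _; rewrite divr_gt0 ?ltr0n. Qed.

Lemma slopeM v : primitive v -> slope v * v.1%:R = v.2%:R.
Proof. by case/and3P=> v1 v2 _; rewrite divfK // pnatr_eq0 -lt0n. Qed.

Lemma steeper_slope v w : primitive v -> primitive w -> steeper v w -> slope w <= slope v.
Proof.
move=> /and3P[v1 _ _] /and3P[w1 _ _]; rewrite /steeper /slope => h.
by rewrite ler_pdivrMr ?ltr0n // mulrAC ler_pdivlMr ?ltr0n // -!natrM ler_nat.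
Qed.

Lemma profile_ge0 L x : 0 <= profile L x.
Proof. by elim: L x => //= v L IH x; rewrite le_max IH orbT. Qed.

Lemma profile_ge_line L s x : 0 <= s -> all (fun w => slope w <= s) L -> 0 <= x ->
  (height L)%:R - s * x <= profile L x.
Proof.
move=> s0 + x0; case: L => [|v L] /=.
  by rewrite /height big_nil sub0r oppr_le0 mulr_ge0.
by move=> /andP[vs _]; rewrite height_cons le_max lerB // ler_wpM2r.
Qed.

Lemma profile_le_line L s x : convex_path L -> 0 <= s ->
  all (fun w => slope w <= s) L -> x <= 0 -> profile L x <= (height L)%:R - s * x.
Proof.
elim: L s x => [|v L IH] s x; rewrite ?convex_path_cons /=.
  by rewrite /height big_nil sub0r oppr_ge0; move=> *; rewrite mulr_ge0_le0.
move=> /and3P[pv vL cL] s0 /andP[vs sL] x0; rewrite height_cons ge_max.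
have sx : s * x <= slope v * x by rewrite ler_wnM2r.
apply/andP; split; first by rewrite lerD2l lerN2.
apply: (le_trans (IH (slope v) _ cL (ltW (slope_gt0 pv)) _ _)).
- case/andP: cL => pL _; apply/allP => w wL; apply: steeper_slope => //.
    exact: (allP pL).
  exact: (allP vL).
- by rewrite subr_le0 (le_trans x0) ?ler0n.
- by rewrite mulrBr slopeM // natrD; lra.
Qed.

Lemma convex_path_slopes v L : convex_path (v :: L) ->
  all (fun w => slope w <= slope v) L.
Proof.
rewrite convex_path_cons => /and3P[pv vL /andP[pL _]]; apply/allP => w wL.
by apply: steeper_slope => //; [exact: (allP pL)|exact: (allP vL)].
Qed.

Lemma profile_left v L x : convex_path (v :: L) -> x <= v.1%:R ->
  profile (v :: L) x = (v.2 + height L)%:R - slope v * x.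
Proof.
move=> cvL xv; have sL := convex_path_slopes cvL.
move: cvL; rewrite convex_path_cons => /and3P[pv _ cL].
apply/max_idPl/(le_trans (profile_le_line cL (ltW (slope_gt0 pv)) sL _)).
  by rewrite subr_le0.
by rewrite mulrBr slopeM // natrD; lra.
Qed.

Lemma profile_right v L x : convex_path (v :: L) -> v.1%:R <= x ->
  profile (v :: L) x = profile L (x - v.1%:R).
Proof.
move=> cvL xv; have sL := convex_path_slopes cvL.
move: cvL; rewrite convex_path_cons => /and3P[pv _ cL].
apply/max_idPr/(le_trans _ (profile_ge_line (ltW (slope_gt0 pv)) sL _)).
  by rewrite mulrBr slopeM // natrD; lra.
by rewrite subr_ge0.
Qed.

Lemma profile_eq0 L x : convex_path L -> (width L)%:R <= x -> profile L x = 0.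
Proof.
elim: L x => // v L IH x cvL; rewrite width_cons natrD => wx.
have w0 : 0 <= (width L)%:R :> R by [].
rewrite profile_right //; last lra.
by rewrite IH //; [move: cvL; rewrite convex_path_cons => /and3P[]|lra].
Qed.

Lemma profile_gt0 L x : all primitive L -> 0 <= x -> x < (width L)%:R -> 0 < profile L x.
Proof.
elim: L x => [|v L IH] x /=; first by rewrite /width big_nil; lra.
move=> /andP[pv pL] x0; rewrite width_cons natrD lt_max => xw.
have [xv|xv] := ltP x v.1%:R; last by rewrite IH ?orbT //; lra.
apply/orP; left; rewrite natrD.
have : slope v * x < v.2%:R by rewrite -slopeM // ltr_pM2l ?slope_gt0.
by have : 0 <= (height L)%:R :> R by []; lra.
Qed.

Lemma profile0 L : convex_path L -> profile L 0 = (height L)%:R.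
Proof.
case: L => [|v L]; first by rewrite /height big_nil.
by move=> c; rewrite profile_left // mulr0 subr0 height_cons.
Qed.

Lemma profile_convex L x y t : 0 <= t <= 1 ->
  profile L (t * x + (1 - t) * y) <= t * profile L x + (1 - t) * profile L y.
Proof.
move=> /andP[t0 t1]; elim: L x y => [|v L IH] x y /=; first by rewrite !mulr0 addr0.
rewrite ge_max; set b := (_ + _)%:R.
have t1' : 0 <= 1 - t by rewrite subr_ge0.
have le_ (a c : R) (d e : R) : a <= d -> c <= e ->
    t * a + (1 - t) * c <= t * d + (1 - t) * e.
  by move=> ad ce; apply: lerD; apply: ler_wpM2l.
apply/andP; split.
  rewrite (_ : _ - _ = t * (b - slope v * x) + (1 - t) * (b - slope v * y)); last ring.
  by apply: le_; rewrite le_max lexx.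
rewrite (_ : _ - _ = t * (x - v.1%:R) + (1 - t) * (y - v.1%:R)); last ring.
by apply: (le_trans (IH _ _)); apply: le_; rewrite le_max lexx orbT.
Qed.

Lemma profile_nonincreasing L x y : all primitive L -> x <= y -> profile L y <= profile L x.
Proof.
elim: L x y => //= v L IH x y /andP[pv pL] xy; rewrite ge_max.
rewrite le_max lerD2l lerN2 ler_pM2l ?slope_gt0 // xy /= le_max.
by rewrite IH ?orbT // lerD2r.
Qed.

Lemma profile_continuous L : continuous (profile L).
Proof.
elim: L => [|v L IH] x /=; first exact: cvg_cst.
apply: (@continuous_max _ _ (fun x => _ - slope v * x) (fun x => profile L (x - v.1%:R))).
  by apply: cvgB; [exact: cvg_cst|apply: cvgMr; exact: cvg_id].
apply: continuous_comp; last exact: IH.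
by apply: cvgB; [exact: cvg_id|exact: cvg_cst].
Qed.

Lemma profile_above L (x y : nat) : convex_path L ->
  (profile L x%:R <= y%:R) = above L x y.
Proof.
elim: L x => [|v L IH] x cvL; first by rewrite /= ler0n.
have := cvL; rewrite convex_path_cons => /and3P[pv _ cL].
have [xv|xv] := ltnP x v.1; last first.
  by rewrite profile_right ?ler_nat // -natrB // IH //= ltnNge xv.
rewrite profile_left ?ler_nat 1?ltnW //= xv.
have v1 : 0 < v.1%:R :> R by case/and3P: pv; rewrite ltr0n.
rewrite -(ler_nat R) -[LHS](ler_pM2l v1) !(natrD, natrM).
by rewrite -(slopeM pv); apply/idP/idP; lra.
Qed.

(** On the graph the maximum is attained by the affine function of some step, whose
line supports the epigraph and has a strictly positive normal vector. *)
Lemma profile_supporting L x : L != [::] -> all primitive L -> x <= (width L)%:R ->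
  exists c : R * R, [/\ 0 < c.1, 0 < c.2 &
    forall x', c.1 * x + c.2 * profile L x <= c.1 * x' + c.2 * profile L x'].
Proof.
elim: L x => // v L IH x _ /= /andP[pv pL]; rewrite width_cons natrD => xw.
have [h|h] := leP (profile L (x - v.1%:R)) ((v.2 + height L)%:R - slope v * x).
  exists (slope v, 1); split => //=; first exact: slope_gt0.
  move=> x'; rewrite !mul1r addrC subrK -lerBlDl le_max.
  by rewrite lexx.
case: L IH pL xw h => [|w L] IH pL xw h.
  move: h xw; rewrite /= width_nil height_nil addn0 => h xw.
  have xv : x <= v.1%:R by lra.
  have : slope v * x <= v.2%:R by rewrite -slopeM // ler_pM2l ?slope_gt0.
  lra.
have [|c [c1 c2 hc]] := IH (x - v.1%:R) isT pL; first lra.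
exists c; split => // x'.
have := hc (x' - v.1%:R); set f := profile (w :: L) (x' - _).
have : c.2 * f <= c.2 * Num.max ((v.2 + height (w :: L))%:R - slope v * x') f.
  by rewrite ler_pM2l // le_max lexx orbT.
lra.
Qed.

End NewtonFunction.
Arguments profile {R} L x : simpl never.

(** * Newton polyhedron and Newton boundary *)

Section PlaneGeometry.
Local Open Scope classical_set_scope.
Variable R : realType.
Implicit Types (L : seq step) (z w : R * R) (x y t d : R).

Definition epigraph L : set (R * R) := [set z | 0 <= z.1 /\ profile L z.1 <= z.2].

Definition graph L : set (R * R) :=
  [set z | 0 <= z.1 <= (width L)%:R /\ z.2 = profile L z.1].

Lemma convex_setP (A : set (R * R)) : @convex_set R (R * R)%type A <->
  (forall z w t, 0 <= t <= 1 -> A z -> A w ->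
    A (t * z.1 + (1 - t) * w.1, t * z.2 + (1 - t) * w.2)).
Proof.
split=> [cA z w t /andP[t0 t1] Az Aw|cA z w t].
  have := cA z w (Itv01 t0 t1); rewrite !inE => /(_ Az Aw).
  by rewrite /conv /=.
rewrite !inE => Az Aw; have := cA z w t%:num _ Az Aw; apply.
by apply/andP; split.
Qed.

Lemma epigraph_convex L : @convex_set R (R * R)%type (epigraph L).
Proof.
apply/convex_setP => z w t t01 [z1 z2] [w1 w2]; have /andP[t0 t1] := t01.
have t1' : 0 <= 1 - t by rewrite subr_ge0.
split=> /=; first by rewrite addr_ge0 // mulr_ge0.
apply: (le_trans (profile_convex _ _ _ t01)).
by apply: lerD; apply: ler_wpM2l.
Qed.

Definition plane_up (H : set (R * R)) := forall z x y, H z -> 0 <= x -> 0 <= y ->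
  H (z.1 + x, z.2 + y).

(** Over the first step, the epigraph consists of the points above a segment whose ends
are lattice points; the rest follows by induction, with H translated. *)
Lemma epigraph_in_convex L (H : set (R * R)) : convex_path L ->
  @convex_set R (R * R)%type H -> plane_up H ->
  (forall x y : nat, above L x y -> H (x%:R, y%:R)) -> epigraph L `<=` H.
Proof.
elim: L H => [|v L IH] H cvL cH uH HL [x y] [x0]; rewrite -[_.2]/y -[_.1]/x => hxy.
  by have := uH _ x y (HL 0%N 0%N isT) x0 hxy; rewrite /= !add0r.
have := cvL; rewrite convex_path_cons => /and3P[pv _ cL].
have v1 : 0 < v.1%:R :> R by case/and3P: pv; rewrite ltr0n.
have pvL : all primitive (v :: L) by case/andP: cvL.
have [xv|vx] := leP x v.1%:R; last first.
  have := IH [set z | H (z.1 + v.1%:R, z.2)] cL; move/(_ _ _ _ (x - v.1%:R, y)).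
  rewrite /= subrK; apply.
  - apply/convex_setP => z w t t01 /= Hz Hw.
    have := (convex_setP H).1 cH _ _ t t01 Hz Hw => /=.
    rewrite (_ : _ + _ * (w.1 + _) = t * z.1 + (1 - t) * w.1 + v.1%:R) //; ring.
  - move=> z a b /= Hz a0 b0; have := uH _ a b Hz a0 b0.
    by rewrite /= addrAC.
  - move=> a b ab /=; rewrite -natrD; apply: HL => /=.
    by rewrite ltnNge leq_addl addnK.
  - split=> /=; first by rewrite subr_ge0 ltW.
    by rewrite -profile_right // ltW.
move: hxy; rewrite profile_left // => hxy.
pose t := x / v.1%:R.
have t01 : 0 <= t <= 1 by rewrite divr_ge0 ?ler_pdivrMr ?mul1r // ltW.
have H1 : H (v.1%:R, (height L)%:R).
  by apply: HL; rewrite /= ltnn subnn; apply: above_start; case/andP: cL.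
have H0 : H (0%:R, (height (v :: L))%:R) by apply: HL; exact: above_start.
have := (convex_setP H).1 cH _ _ t t01 H1 H0; rewrite /= mulr0n mulr0 addr0.
rewrite /t divfK ?gt_eqF // -/t => Hx.
have := uH _ 0 (y - ((v.2 + height L)%:R - slope R v * x)) Hx (lexx _) _.
rewrite /= addr0 (_ : _ + _ + _ = y); first by apply; rewrite subr_ge0.
rewrite height_cons !natrD /slope /t.
move: v1; set a := v.1%:R; move=> a0; rewrite -/a.
by field; rewrite gt_eqF.
Qed.

Lemma convex_hull_lattice L : convex_path L ->
  convex_hull [set z : R * R | exists x y : nat, above L x y /\ z = (x%:R, y%:R)]
  = epigraph L.
Proof.
move=> cL; rewrite /convex_hull; apply/seteqP; split.
  apply: smallest_sub; first exact: epigraph_convex.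
  move=> _ [x [y [xy ->]]]; split=> /=; first exact: ler0n.
  by rewrite profile_above.
move=> z Lz H [cH GH].
have pL : all primitive L by case/andP: cL.
(* The points whose translates by the real quadrant all lie in H form an up-closed
   convex set, so it is enough to find the lattice points above L in it. *)
pose H' : set (R * R) := [set z | forall x y, 0 <= x -> 0 <= y -> H (z.1 + x, z.2 + y)].
suff : epigraph L `<=` H'.
  by move=> /(_ _ Lz 0 0 (lexx _) (lexx _)); rewrite !addr0 -surjective_pairing.
apply: epigraph_in_convex => //.
- apply/convex_setP => u w t t01 Hu Hw x y x0 y0 /=.
  have := (convex_setP H).1 cH _ _ t t01 (Hu x y x0 y0) (Hw x y x0 y0) => /=.
  by rewrite !mulrDr !mulrBl; congr (H (_, _)); ring.
- move=> u x y Hu x0 y0 a b a0 b0 /=; rewrite -!addrA.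
  by apply: Hu; rewrite addr_ge0.
move=> a b ab x y x0 y0 /=.
pose m := (Num.truncn x).+1; pose n := (Num.truncn y).+1.
have xm : x <= m%:R by rewrite ltW // truncnS_gt.
have yn : y <= n%:R by rewrite ltW // truncnS_gt.
have Hl (i j : nat) : (a <= i)%N -> (b <= j)%N -> H (i%:R, j%:R).
  by move=> ai bj; apply: GH; exists i, j; split=> //; apply: above_up ab.
have m0 : 0 < m%:R :> R by rewrite ltr0n.
have n0 : 0 < n%:R :> R by rewrite ltr0n.
have tx : 0 <= x / m%:R <= 1 by rewrite divr_ge0 ?ler_pdivrMr ?mul1r // ltW.
have ty : 0 <= y / n%:R <= 1 by rewrite divr_ge0 ?ler_pdivrMr ?mul1r // ltW.
(* A real translate of a lattice point is reached by a convex combination of lattice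
   points, first along its row and then along its column. *)
have hrow j : (b <= j)%N -> H (a%:R + x, j%:R).
  move=> bj; have := (convex_setP H).1 cH _ _ _ tx (Hl (a + m)%N j _ bj) (Hl a j _ bj).
  move=> /(_ (leq_addr _ _) (leqnn _)) /=; congr (H (_, _)); last ring.
  by rewrite natrD; field; rewrite gt_eqF.
have := (convex_setP H).1 cH _ _ _ ty (hrow (b + n)%N (leq_addr _ _)) (hrow b (leqnn _)).
move=> /=; congr (H (_, _)); first ring.
by rewrite natrD; field; rewrite gt_eqF.
Qed.

Lemma closed_le_fun (T : topologicalType) (f g : T -> R) :
  continuous f -> continuous g -> closed [set u | f u <= g u].
Proof.
move=> cf cg; have -> : [set u | f u <= g u] = (fun u => g u - f u) @^-1` [set x | 0 <= x].
  by apply/seteqP; split=> u /=; rewrite subr_ge0.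
apply: preimage_closed; last exact: closed_ge.
by move=> u _; apply: cvgB; [exact: cg|exact: cf].
Qed.

Lemma open_lt_fun (T : topologicalType) (f g : T -> R) :
  continuous f -> continuous g -> open [set u | f u < g u].
Proof.
move=> cf cg; have -> : [set u | f u < g u] = ~` [set u | g u <= f u].
  by apply/seteqP; split=> u /=; rewrite ltNge => /negP.
by apply: closed_openC; exact: closed_le_fun.
Qed.

Lemma fst_cont : continuous (fst : R * R -> R).
Proof. by move=> z; exact: cvg_fst. Qed.

Lemma snd_cont : continuous (snd : R * R -> R).
Proof. by move=> z; exact: cvg_snd. Qed.

Lemma profile_fst_cont L : continuous (fun z : R * R => profile L z.1).
Proof. by move=> z; apply: continuous_comp; [exact: fst_cont|exact: profile_continuous]. Qed.

Lemma bounded_setP (A : set (R * R)) : bounded_set A ->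
  exists M, forall z, A z -> z.1 <= M /\ z.2 <= M /\ - M <= z.1 /\ - M <= z.2.
Proof.
case=> M [_ hM]; exists (M + 1) => z Az.
have : `|z| <= M + 1 by apply: (hM (M + 1)) => //; rewrite ltrDl.
by rewrite prod_normE ge_max !ler_norml => /andP[/andP[-> ->] /andP[-> ->]].
Qed.

(** The epigraph contains vertical and horizontal rays from each of its points, so a
linear function bounded below on it has nonnegative coefficients, and these are
positive if the face is bounded. Such a function can only be minimal on the graph:
above the graph one can go down, and to the right of the path one can go left.
Conversely a face cut out with positive coefficients is bounded. *)
Lemma compact_faces_epigraph L : L != [::] -> convex_path L ->
  compact_faces (epigraph L) = graph L.
Proof.
move=> L0 cL; have pL : all primitive L by case/andP: cL.
apply/seteqP; split=>
  [z [F [[c [d [Pd ->]]] /compact_bounded/bounded_setP[M hM]] [Pz /= cz]]|z].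
  have [z1 z2] := Pz.
  have right t : 0 <= t -> epigraph L (z.1 + t, z.2).
    move=> t0; split=> /=; first by rewrite addr_ge0.
    by apply: le_trans z2; apply: profile_nonincreasing => //=; rewrite lerDl.
  have up t : 0 <= t -> epigraph L (z.1, z.2 + t).
    by move=> t0; split=> //=; rewrite (le_trans z2) // lerDl.
  have c10 : 0 <= c.1 by have := Pd _ (right 1 ler01); rewrite /=; lra.
  have c20 : 0 <= c.2 by have := Pd _ (up 1 ler01); rewrite /=; lra.
  have M0 : 0 <= M.
    by have [_ [_ [+ _]]] := hM z (conj Pz cz); have [+ _] := hM z (conj Pz cz); lra.
  have {}c10 : 0 < c.1.
    rewrite lt_neqAle c10 andbT; apply/eqP => c1.
    have [|+ _] := hM (z.1 + (M + 1), z.2).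
    by split; [apply: right; rewrite addr_ge0|rewrite /= -cz -c1 !mul0r].
    by rewrite /=; lra.
  have {}c20 : 0 < c.2.
    rewrite lt_neqAle c20 andbT; apply/eqP => c2.
    have [|_ [+ _]] := hM (z.1, z.2 + (M + 1)).
    by split; [apply: up; rewrite addr_ge0|rewrite /= -cz -c2 !mul0r].
    by rewrite /=; have := profile_ge0 L z.1; lra.
  split.
    rewrite z1 /= leNgt; apply/negP => wz.
    have := Pd ((width L)%:R, 0); rewrite /epigraph /= profile_eq0 // lexx ler0n.
    move=> /(_ (conj isT isT)); rewrite -cz mulr0 addr0.
    have : c.1 * (width L)%:R < c.1 * z.1 by rewrite ltr_pM2l.
    have : 0 <= c.2 * z.2 by rewrite mulr_ge0 ?(ltW c20) // (le_trans (profile_ge0 L z.1)).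
    lra.
  apply/eqP; rewrite eq_le z2 andbT.
  have := Pd (z.1, profile L z.1) (conj z1 (lexx _)).
  by rewrite -cz /= lerD2l ler_pM2l.
move=> [/andP[z10 z1w] z2].
have [c [c1 c2 hc]] := profile_supporting L0 pL z1w.
set d := c.1 * z.1 + c.2 * profile L z.1 in hc.
have Pd w : epigraph L w -> d <= c.1 * w.1 + c.2 * w.2.
  by move=> [_ w2]; apply: (le_trans (hc w.1)); rewrite lerD2l ler_pM2l.
exists (epigraph L `&` [set p | c.1 * p.1 + c.2 * p.2 = d]); last first.
  by split=> //=; [split; rewrite ?z2|rewrite z2].
split; first by exists c, d.
apply: (@subclosed_compact _ _ (`[0, d / c.1] `*` `[0, d / c.2])).
- have -> : epigraph L `&` [set p | c.1 * p.1 + c.2 * p.2 = d] =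
    [set w | 0 <= w.1] `&` [set w | profile L w.1 <= w.2]
    `&` [set w | c.1 * w.1 + c.2 * w.2 <= d].
    apply/seteqP; split=> w /= [[w1 w2] hw]; split => //; first by rewrite hw.
    by apply/eqP; rewrite eq_le hw Pd.
  apply: closedI; first apply: closedI.
  + by apply: closed_le_fun; [move=> ?; exact: cvg_cst|exact: fst_cont].
  + by apply: closed_le_fun; [exact: profile_fst_cont|exact: snd_cont].
  + apply: closed_le_fun; last by move=> ?; exact: cvg_cst.
    move=> w; apply: cvgD; apply: cvgMr; [exact: fst_cont|exact: snd_cont].
- by apply: compact_setX; exact: segment_compact.
move=> w [[w1 w2] /= hw]; have w20 : 0 <= w.2 by exact: le_trans (profile_ge0 _ _) w2.
have h1 : 0 <= c.1 * w.1 by rewrite mulr_ge0 // ltW.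
have h2 : 0 <= c.2 * w.2 by rewrite mulr_ge0 // ltW.
by split; rewrite /= in_itv /= ?w1 ?w20 ler_pdivlMr // mulrC; lra.
Qed.

End PlaneGeometry.

(** * Intersections with the axes *)

Section NewtonRegion.
Local Open Scope classical_set_scope.
Variable R : realType.
Implicit Types (L : seq step) (z w : R * R) (x y t d : R).

Lemma graph_x_axis L : convex_path L ->
  xget 0 [set a : R | graph L (a, 0)] = (width L)%:R.
Proof.
move=> cL; apply: xget_unique.
  by split=> /=; [rewrite ler0n lexx|rewrite profile_eq0].
move=> a [/= /andP[a0 aw] e]; apply/eqP; rewrite eq_le aw /= leNgt.
apply/negP => /(profile_gt0 _) h.
by have := h _; case/andP: cL => pL _ => /(_ pL a0); rewrite -e ltxx.
Qed.

Lemma graph_y_axis L : convex_path L ->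
  xget 0 [set b : R | graph L (0, b)] = (height L)%:R.
Proof.
move=> cL; apply: xget_unique; first by split=> /=; rewrite ?lexx ?ler0n ?profile0.
by move=> b [/= _ ->]; rewrite profile0.
Qed.

(** * Lattice points on the Newton boundary *)

Fixpoint vertices L : seq (nat * nat) :=
  if L is v :: L' then
    (0%N, (v.2 + height L')%N) :: [seq (u.1 + v.1, u.2)%N | u <- vertices L']
  else [:: (0, 0)%N].

Lemma size_vertices L : size (vertices L) = (size L).+1.
Proof. by elim: L => //= v L IH; rewrite size_map IH. Qed.

Lemma vertices_uniq L : all primitive L -> uniq (vertices L).
Proof.
elim: L => //= v L IH /andP[/and3P[v1 _ _] pL]; rewrite map_inj_uniq ?IH ?andbT //.
  by apply/mapP => -[[a b] _ /= []]; lia.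
by move=> [a b] [c d] /= [/addIn -> ->].
Qed.

(** A lattice point on the line of a primitive step (p, q), in one of the columns
0, ..., p - 1 of this step, has p dividing q x, hence x = 0. *)
Lemma graph_lattice L (x y : nat) : convex_path L ->
  graph L (x%:R : R, y%:R : R) <-> (x, y) \in vertices L.
Proof.
elim: L x => [|v L IH] x cvL.
  rewrite /graph /= width_nil inE; split.
    move=> [/andP[_ +] /eqP]; rewrite pnatr_eq0 ler_nat leqn0 => /eqP-> /eqP->.
    by rewrite eqxx.
  by move=> /eqP[-> ->]; rewrite lexx.
have := cvL; rewrite convex_path_cons => /and3P[pv _ cL].
have /and3P[v1 v2 co] := pv.
have mem_tl : (x < v.1)%N ->
    (x, y) \in [seq (u.1 + v.1, u.2)%N | u <- vertices L] = false.
  by move=> xv; apply/mapP => -[[a b] _ [/= e _]]; lia.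
have [xv|xv] := ltnP x v.1.
  rewrite /= inE mem_tl // orbF /graph /= profile_left //; last by rewrite ler_nat ltnW.
  rewrite width_cons ler0n ler_nat /= (leq_trans (ltnW xv)) ?leq_addr //.
  split=> [[_ e]|/eqP[-> ->]]; last by split=> //; rewrite mulr0 subr0.
  have {}e : (v.1 * y + v.2 * x = v.1 * (v.2 + height L))%N.
    apply/eqP; rewrite -(eqr_nat R) natrD !natrM e -(slopeM R pv); apply/eqP; ring.
  have : (v.1 %| v.2 * x)%N.
    by rewrite -(dvdn_addr _ (dvdn_mulr y (dvdnn v.1))) e dvdn_mulr.
  rewrite Gauss_dvdr // => /dvdnP[[|m] ex]; last by nia.
  have x0 : x = 0%N by [].
  move: e; rewrite x0 muln0 addn0 => /eqP; rewrite eqn_pmul2l // => /eqP->.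
have -> : ((x, y) \in vertices (v :: L)) = ((x - v.1, y)%N \in vertices L).
  rewrite /= inE (_ : _ == _ = false) /=; last by apply/eqP => -[]; lia.
  apply/mapP/idP => [[[a b] h [-> ->]]|h]; first by rewrite /= addnK.
  by exists (x - v.1, y)%N => //=; rewrite subnK.
rewrite -IH // /graph /=.
rewrite profile_right ?ler_nat // -natrB // !ler0n /= ?ler_nat width_cons.
by rewrite leq_subLR.
Qed.

Lemma card_graph_lattice L : convex_path L ->
  #|` fset_set [set z : int * int | graph L (z.1%:~R, z.2%:~R : R)] | = (size L).+1.
Proof.
move=> cL; have pL : all primitive L by case/andP: cL.
pose s : seq (int * int) := [seq (Posz u.1, Posz u.2) | u <- vertices L].
have -> : [set z : int * int | graph L (z.1%:~R, z.2%:~R : R)] =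
    [set` [fset z in s]%fset].
  apply/seteqP; split=> [[a b] /= h|[a b]] /=.
    rewrite !inE /=; move: (h) => [/andP[/= + _] /= e].
    have : 0 <= (b%:~R : R) by rewrite e profile_ge0.
    rewrite !ler0z => b0 a0; case: a b a0 b0 h {e} => // a [] // b _ _.
    rewrite -!pmulrn /= => /(graph_lattice _ _ cL) h.
    by apply/mapP; exists (a, b).
  rewrite !inE => /mapP[[c d] + [-> ->]] => /(graph_lattice _ _ cL).
  by rewrite -!pmulrn.
rewrite set_fsetK card_fseq undup_id ?size_map ?size_vertices //.
by rewrite map_inj_uniq ?vertices_uniq // => -[a b] [c d] [-> ->].
Qed.

(** * Area below the Newton boundary *)

Definition undergraph L : set (R * R) :=
  [set z | 0 <= z.1 <= (width L)%:R /\ 0 <= z.2 <= profile L z.1].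

Lemma integral_affine (b s X p : R) : 0 < p ->
  (\int[lebesgue_measure]_(x in `[X, (X + p)%R]) (b - s * (x - X))%R%:E =
  (p * b - s * p ^+ 2 / 2)%R%:E)%E.
Proof.
move=> p0; pose F x : R := b * (x - X) - s / 2 * (x - X) ^+ 2.
have dF x : is_derive x 1 F (b - s * (x - X)).
  rewrite /F; apply: is_derive_eq; rewrite /GRing.scale /=.
  by field.
have cF : continuous F.
  by move=> x; apply/differentiable_continuous/derivable1_diffP; exact: ex_derive.
rewrite (@continuous_FTC2 _ _ F).
- by rewrite -EFinB /F; congr EFin; field.
- by rewrite ltrDl.
- apply: continuous_subspaceT => x.
  by apply: cvgB; [exact: cvg_cst|apply: cvgMr; apply: cvgB; [exact: cvg_id|exact: cvg_cst]].
- split; [by move=> x _; exact: ex_derive| |].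
  + by apply: cvg_at_right_filter; exact: cF.
  + by apply: cvg_at_left_filter; exact: cF.
- by move=> x _; rewrite derive1E; exact: derive_val.
Qed.

Lemma profile_measurable L X (D : set R) : measurable D ->
  measurable_fun D ((fun x => (profile L (x - X)%R)%:E) : R -> \bar R).
Proof.
move=> mD; apply/measurable_EFinP; apply: measurable_funTS.
apply: continuous_measurable_fun => x.
apply: (@continuous_comp _ _ _ (fun x => x - X) (profile L)); last exact: profile_continuous.
by apply: cvgB; [exact: cvg_id|exact: cvg_cst].
Qed.

(** The translation by X is carried through the induction so that the integral over
the remaining steps has again the form of the statement. *)
Lemma integral_profile L X : convex_path L ->
  (\int[lebesgue_measure]_(x in `[X, (X + (width L)%:R)%R]) (profile L (x - X)%R)%:E =
  ((mixed L L)%:R / 2 : R)%R%:E)%E.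
Proof.
elim: L X => [|v L IH] X cvL.
  rewrite width_nil addr0 set_itv1 integral_set1.
  by rewrite /mixed big_nil mul0r.
have := cvL; rewrite convex_path_cons => /and3P[pv vL cL].
have v1 : 0 < v.1%:R :> R by case/and3P: pv; rewrite ltr0n.
have w0 : 0 <= (width L)%:R :> R by [].
have -> : `[X, X + (width (v :: L))%:R] =
    `[X, X + v.1%:R] `|` `]X + v.1%:R, X + v.1%:R + (width L)%:R].
  rewrite width_cons natrD addrA -itv_bndbnd_setU // bnd_simp.
    by rewrite lerDl ltW.
  by rewrite lerDl.
rewrite ge0_integral_setU //=; first last.
- apply/disj_set2P/seteqP; split=> // x [/=]; rewrite !in_itv /=.
  by move=> /andP[_ h1] /andP[+ _]; rewrite ltNge h1.
- by move=> x _; rewrite lee_fin profile_ge0.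
- by apply: profile_measurable; exact: measurableU.
rewrite integral_itv_obnd_cbnd; last exact: profile_measurable.
transitivity ((\int[lebesgue_measure]_(x in `[X, (X + v.1%:R)%R])
    ((v.2 + height L)%:R - slope R v * (x - X))%R%:E) +
  (\int[lebesgue_measure]_(x in `[(X + v.1%:R)%R, (X + v.1%:R + (width L)%:R)%R])
    (profile L (x - (X + v.1%:R))%R)%:E))%E.
  congr (_ + _)%E; apply: eq_integral => x; rewrite inE /= in_itv /= => /andP[vx xv].
    by rewrite profile_left //; lra.
  by rewrite profile_right ?opprD ?addrA //; lra.
rewrite integral_affine //.
rewrite IH // -EFinD; congr EFin; rewrite mixed_cons // !(natrD, natrM) -(slopeM R pv).
by field.
Qed.

Lemma area_undergraph L : convex_path L ->
  area (undergraph L) = (mixed L L)%:R / 2.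
Proof.
move=> cL; rewrite /area /product_measure1 /=.
rewrite (_ : (\int[_]_x _)%E = ((mixed L L)%:R / 2 : R)%R%:E) //.
rewrite -(integral_profile 0 cL) add0r [RHS]integral_mkcond.
apply: eq_integral => x _; rewrite /patch /=.
case: ifPn => [|x0]; first rewrite inE /= in_itv /= => x0.
  rewrite (_ : xsection _ _ = `[0, profile L x]).
    rewrite lebesgue_measure_itv /= subr0 lte_fin.
    by have := profile_ge0 L x; rewrite le_eqVlt => /predU1P[<-|->]; rewrite ?ltxx ?oppr0 ?adde0.
  apply/seteqP; split=> y; rewrite /xsection /= inE in_itv /undergraph /=.
    by case.
  by move=> y0; split.
rewrite (_ : xsection _ _ = set0) ?measure0 //.
apply/seteqP; split=> y //; rewrite /xsection /= inE /undergraph /= => -[h _].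
by move: x0; rewrite notin_setE /= in_itv /= h.
Qed.

End NewtonRegion.

(** * The region bounded by the Newton boundary and the axes *)

Section JordanRegion.
Local Open Scope classical_set_scope.
Variable R : realType.
Implicit Types (L : seq step) (z w : R * R) (x y t d : R).

(** A ray that avoids C stays in the connected component of its origin. *)
Lemma bounded_component_ray (C : set (R * R)) z (e : R * R) :
  (forall t, 0 <= t -> ~ C (z.1 + t * e.1, z.2 + t * e.2)) ->
  bounded_set (connected_component (~` C) z) ->
  exists M, forall t, 0 <= t -> (z.1 + t * e.1 <= M /\ z.2 + t * e.2 <= M) /\
    (- M <= z.1 + t * e.1 /\ - M <= z.2 + t * e.2).
Proof.
move=> rayC /bounded_setP[M hM]; exists M => t t0.
pose f (s : R) : R * R := (z.1 + s * e.1, z.2 + s * e.2).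
suff /hM [? [? [? ?]]] : connected_component (~` C) z (f t) by [].
apply: (@connected_component_max _ _ (f @` `[0, t])).
- by exists 0; rewrite /= ?in_itv /= ?lexx // /f !mul0r !addr0 -surjective_pairing.
- by move=> _ [s /= + <-]; rewrite in_itv /= => /andP[s0 _]; exact: rayC.
- apply: connected_continuous_connected; first exact: segment_connected.
  apply: continuous_subspaceT => s.
  have aff (a b : R) : (a + s' * b) @[s' --> s] --> a + s * b.
    by apply: cvgD; [exact: cvg_cst|apply: cvgMl; exact: cvg_id].
  exact: cvg_pair (aff z.1 e.1) (aff z.2 e.2).
- by exists t => //=; rewrite in_itv /= t0 lexx.
Qed.

Definition newton_curve L : set (R * R) :=
  graph L `|` [set (t, 0) | t in `[0, (width L)%:R]]
          `|` [set (0, t) | t in `[0, (height L)%:R]].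

Lemma profile_le_height L x : convex_path L -> 0 <= x -> profile L x <= (height L)%:R :> R.
Proof.
by move=> cL x0; rewrite -profile0 // profile_nonincreasing //; case/andP: cL.
Qed.

Lemma newton_curve_sub L : convex_path L -> newton_curve L `<=` undergraph L.
Proof.
move=> cL [x y] [[[/= xw ->]|[t tw [<- <-]]]|[t th [<- <-]]].
- by split=> //=; rewrite lexx profile_ge0.
- by move: tw; rewrite /= in_itv /= => tw; split=> //=; rewrite lexx profile_ge0.
- by move: th; rewrite /= in_itv /= => th; split=> /=; rewrite ?lexx ?ler0n ?profile0.
Qed.

Definition newton_interior L : set (R * R) :=
  [set z | 0 < z.1] `&` [set z | 0 < z.2] `&` [set z | z.2 < profile L z.1].

Lemma newton_interior_sub L : convex_path L -> newton_interior L `<=` undergraph L.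
Proof.
move=> cL z [[/= z1 z2] z3]; split; rewrite /= ?(ltW z1) ?(ltW z2) ?(ltW z3) //=.
rewrite leNgt; apply/negP => /ltW wz.
by move: z3; rewrite profile_eq0 // => /(lt_trans z2); rewrite ltxx.
Qed.

Lemma newton_curve_interior L z : convex_path L ->
  newton_curve L z -> ~ newton_interior L z.
Proof.
move=> cL; case: z => x y [[[/= _ ->]|[t _ [<- <-]]]|[t _ [<- <-]]] [[/= h1 h2] h3].
- by rewrite ltxx in h3.
- by rewrite ltxx in h2.
- by rewrite ltxx in h1.
Qed.

Lemma undergraphU L z : convex_path L -> undergraph L z ->
  newton_curve L z \/ newton_interior L z.
Proof.
move=> cL; case: z => x y [/= /andP[x0 xw] /andP[y0 yp]].
have [ex|x_gt0] := eqVneq x 0.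
  left; right; exists y; rewrite ?ex //= in_itv /= y0 (le_trans yp) //.
  exact: profile_le_height.
have [ey|y_gt0] := eqVneq y 0.
  by left; left; right; exists x; rewrite ?ey //= in_itv /= x0.
have [ep|yp'] := eqVneq y (profile L x).
  by left; left; left; split=> //=; rewrite x0.
by right; split; [split|] => /=; rewrite lt_neqAle ?x0 ?y0 ?yp ?andbT // eq_sym.
Qed.

Lemma undergraph_closed L : closed (undergraph L : set (R * R)).
Proof.
have -> : undergraph L = ([set z : R * R | 0 <= z.1] `&` [set z | z.1 <= (width L)%:R])
    `&` ([set z | 0 <= z.2] `&` [set z | z.2 <= profile L z.1]).
  apply/seteqP; split=> z /=.
    by move=> [/andP[? ?] /andP[? ?]].
  by move=> [[? ?] [? ?]]; split; apply/andP.
have cst (a : R) : continuous (fun _ : R * R => a) by move=> ?; exact: cvg_cst.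
apply: closedI; apply: closedI; apply: closed_le_fun => //.
- exact: fst_cont.
- exact: fst_cont.
- exact: snd_cont.
- exact: snd_cont.
- exact: profile_fst_cont.
Qed.

Lemma newton_interior_open L : open (newton_interior L : set (R * R)).
Proof.
have cst (a : R) : continuous (fun _ : R * R => a) by move=> ?; exact: cvg_cst.
apply: openI; first apply: openI; apply: open_lt_fun => //.
- exact: fst_cont.
- exact: snd_cont.
- exact: snd_cont.
- exact: profile_fst_cont.
Qed.

Lemma undergraph_bounded L (A : set (R * R)) : convex_path L ->
  A `<=` undergraph L -> bounded_set A.
Proof.
move=> cL Au; exists ((width L)%:R + (height L)%:R); split; first exact: num_real.
move=> M hM z /Au[/andP[z0 zw] /andP[z0' zp]].
have zh := le_trans zp (profile_le_height cL z0).
change (`|z| <= M); rewrite prod_normE ge_max !ger0_norm //.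
have w0 : 0 <= (width L)%:R :> R by [].
have h0 : 0 <= (height L)%:R :> R by [].
by apply/andP; split; lra.
Qed.

(** From a point outside the closed curve and the region it bounds, an axis-parallel
ray goes to infinity without meeting the curve. The interior is open, and its
union with the curve is closed, so the component of an interior point cannot
leave the interior. *)
Lemma region_newton_curve L : convex_path L ->
  region (newton_curve L) = undergraph L :> set (R * R).
Proof.
move=> cL; apply/seteqP; split=> [z [/newton_curve_sub|[nC bC]]|z Uz].
- exact.
- have ray e := @bounded_component_ray _ z e ^~ bC.
  have inC w : newton_curve L w -> undergraph L w by exact: newton_curve_sub.
  have [z1|z1] := ltP z.1 0.
    have [|M hM] := ray (-1, 0).
      move=> t t0 /inC[/andP[/= h _] _]; lra.
    have [_ [/= h _]] := hM (`|M| + 1) (addr_ge0 (normr_ge0 _) ler01).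
    by have := ler_norm M; lra.
  have [z2|z2] := ltP z.2 0.
    have [|M hM] := ray (0, -1).
      by move=> t t0 /inC[_ /andP[/= h _]]; lra.
    have [_ [_ /= h]] := hM (`|M| + 1) (addr_ge0 (normr_ge0 _) ler01).
    by have := ler_norm M; lra.
  have [zw|zw] := ltP (width L)%:R z.1.
    have [|M hM] := ray (1, 0).
      by move=> t t0 /inC[/andP[_ /= h] _]; lra.
    have [[/= h _] _] := hM (`|M| + 1) (addr_ge0 (normr_ge0 _) ler01).
    by have := ler_norm M; lra.
  have [zp|zp] := ltP (profile L z.1) z.2; last by split; apply/andP.
  have [|M hM] := ray (0, 1).
    by move=> t t0 /inC[_ /andP[_ /=]]; rewrite mulr0 addr0; lra.
  have [[_ /= h] _] := hM (`|M| + 1) (addr_ge0 (normr_ge0 _) ler01).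
  by have := ler_norm M; lra.
have [Cz|Dz] := undergraphU cL Uz; first by left.
have nC : ~ newton_curve L z by move=> /(newton_curve_interior cL).
right; split=> //; apply: (undergraph_bounded cL).
apply: subset_trans (newton_interior_sub cL).
set A := connected_component _ _.
have AC w : A w -> ~ newton_curve L w by exact: connected_component_sub.
suff <- : A `&` newton_interior L = A by exact: subIsetr.
have Az : A z by exact: connected_component_refl.
apply: (@component_connected _ (~` newton_curve L) z).
- by exists z.
- by exists (newton_interior L) => //; exact: newton_interior_open.
- exists (undergraph L); first exact: undergraph_closed.
  apply/seteqP; split=> w [Aw].
    by move=> /(newton_interior_sub cL).
  by move=> /(undergraphU cL)[/(AC w Aw)//|Dw].
Qed.

End JordanRegion.

(** * The Newton invariants of an ideal *)

Section NewtonInvariants.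
Local Open Scope classical_set_scope.
Variables (R : realType) (k : fieldType).
Implicit Types (K : ideal (mpoly 2 k)) (L : seq step).

Lemma has_path_above K L (x y : nat) : has_path K L -> all primitive L ->
  (mpolyX k (mono x y) \in K) = above (sort steeper L) x y.
Proof.
move=> KL pL; apply/idP/idP.
  move/(has_path_mono _ _ KL) => h; apply/msumP; first exact: convex_path_sort.
  by apply: msum_perm h; rewrite perm_sym perm_sort.
move/(msumP _ _ (convex_path_sort pL)) => h; apply/(has_path_mono _ _ KL).
by apply: msum_perm h; rewrite perm_sort.
Qed.

(** The exponents outside K are the lattice points below the sorted path. *)
Lemma length_has_path K L : has_path K L -> all primitive L ->
  length R (quot_mod K) = (size (below (sort steeper L)))%:R%:E.
Proof.
move=> KL pL; set C := below _.
have pS : all primitive (sort steeper L) by rewrite all_sort.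
have memC x y : ((x, y) \in C) = (mpolyX k (mono x y) \notin K).
  by rewrite mem_below // (has_path_above _ _ KL).
have KC p : (p \in K) = avoids C p.
  apply/idP/allP => [/KL pK u up|h].
    by rewrite memC negbK; apply/(has_path_mono _ _ KL)/pK.
  apply: ideal_of_support => u /h; rewrite memC negbK.
  by rewrite -monoE.
have dC : down_closed C.
  move=> x y x' y' h xx yy; move: h; rewrite !mem_below //; apply: contra.
  exact: above_up.
have uC : uniq C by exact: below_uniq.
apply/eqP; rewrite eq_le; apply/andP; split; first exact: length_monomial_le.
exact: length_monomial_ge.
Qed.

Lemma newton_boundary_path K L : has_path K L -> all primitive L -> L != [::] ->
  newton_boundary R K = graph (sort steeper L).
Proof.
move=> KL pL L0; have cS := convex_path_sort pL.
rewrite -compact_faces_epigraph //; last first.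
  by rewrite -size_eq0 size_sort size_eq0.
rewrite -convex_hull_lattice // /newton_boundary /newton_polyhedron.
congr (compact_faces (convex_hull _)); apply/seteqP; split=> [_ [u /= uK <-]|_ [x [y [xy ->]]]].
  do 2 eexists; split; [|reflexivity].
  by rewrite -(has_path_above _ _ KL) // -monoE.
by exists (mono x y); rewrite //= (has_path_above _ _ KL).
Qed.

Lemma width_sort L : width (sort steeper L) = width L.
Proof. by apply: perm_big; rewrite perm_sort. Qed.

Lemma height_sort L : height (sort steeper L) = height L.
Proof. by apply: perm_big; rewrite perm_sort. Qed.

(** For the sorted path, the four invariants are read off from the graph of its
profile; none of them depends on the order of the steps. *)
Lemma newton_invariants K L : has_path K L -> all primitive L -> L != [::] ->
  [/\ end_x R K = (width L)%:R, end_y R K = (height L)%:R,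
      boundary_points R K = (size L).+1
    & polygon_area R K = (mixed L L)%:R / 2].
Proof.
move=> KL pL L0; have cS := convex_path_sort pL.
have B := newton_boundary_path KL pL L0.
have ex : end_x R K = (width L)%:R.
  by rewrite /end_x B graph_x_axis // width_sort.
have ey : end_y R K = (height L)%:R.
  by rewrite /end_y B graph_y_axis // height_sort.
split=> //.
  by rewrite /boundary_points B card_graph_lattice // size_sort.
rewrite /polygon_area /newton_polygon B ex ey -width_sort -height_sort.
rewrite -[X in region X]/(newton_curve _) region_newton_curve // area_undergraph //.
by rewrite (@mixed_perm (sort steeper L) L) // perm_sort.
Qed.

Lemma length_path K L : has_path K L -> all primitive L ->
  length R (quot_mod K) = (((mixed L L)%:R + (width L)%:R + (height L)%:R
    - (size L)%:R) / 2)%:E.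
Proof.
move=> KL pL; rewrite (length_has_path KL) //; congr EFin.
have := congr1 (fun n : nat => n%:R : R) (below_size (convex_path_sort pL)).
rewrite (@mixed_perm _ L) ?perm_sort // width_sort height_sort size_sort.
by rewrite !(natrD, natrM); lra.
Qed.

End NewtonInvariants.

(** * The length of R/I^mJ^n *)

Lemma mixed_nseq m L L' : mixed (flatten (nseq m L)) L' = (m * mixed L L')%N.
Proof. by elim: m => [|m IH] /=; rewrite ?mixed_catl ?IH // /mixed big_nil. Qed.

Lemma width_cat L1 L2 : width (L1 ++ L2) = (width L1 + width L2)%N.
Proof. by rewrite /width big_cat. Qed.

Lemma height_cat L1 L2 : height (L1 ++ L2) = (height L1 + height L2)%N.
Proof. by rewrite /height big_cat. Qed.

Lemma width_nseq m L : width (flatten (nseq m L)) = (m * width L)%N.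
Proof. by elim: m => [|m IH] /=; rewrite ?width_nil // width_cat IH. Qed.

Lemma height_nseq m L : height (flatten (nseq m L)) = (m * height L)%N.
Proof. by elim: m => [|m IH] /=; rewrite ?height_nil // height_cat IH. Qed.

Lemma size_flatten_nseq (T : Type) m (s : seq T) :
  size (flatten (nseq m s)) = (m * size s)%N.
Proof. by elim: m => //= m IH; rewrite size_cat IH. Qed.

Theorem theorem3p3 (R : realType) (k : fieldType) (I J : ideal (mpoly 2 k))
    (primI : primary_to (max_ideal k) I) (monI : monomial_ideal I)
    (complI : complete I)
    (primJ : primary_to (max_ideal k) J) (monJ : monomial_ideal J)
    (complJ : complete J)
    (m n : nat) :
  let a K := end_x R K in
  let b K := end_y R K in
  let l K := (boundary_points R K)%:R in
  let s K := polygon_area R K in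
  length R (quot_mod (ideal_mul (ideal_exp I m) (ideal_exp J n))) =
  (s I * m%:R ^+ 2 + s J * n%:R ^+ 2
   + (s (ideal_mul I J) - s I - s J) * m%:R * n%:R
   + 2^-1 * (a I + b I - l I + 1) * m%:R
   + 2^-1 * (a J + b J - l J + 1) * n%:R)%:E.
Proof.
move=> a b l s.
have path K : primary_to (max_ideal k) K -> monomial_ideal K -> complete K ->
    exists L, [/\ all primitive L, L != [::] & has_path K L].
  move=> primK monK complK; have [L cL KL] := complete_has_path primK monK complK.
  exists L; split=> //; first by case/andP: cL.
  apply/eqP => L0; case: (primK) => -[/negP K1 _] _; apply: K1.
  by apply/KL => u _; rewrite L0.
have [LI [pI I0 hI]] := path I primI monI complI.
have [LJ [pJ J0 hJ]] := path J primJ monJ complJ.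
have [aI bI lI sI] := newton_invariants R hI pI I0.
have [aJ bJ lJ sJ] := newton_invariants R hJ pJ J0.
have [||_ _ _ sIJ] := newton_invariants R (has_path_mul hI hJ).
- by rewrite all_cat pI.
- by case: (LI) I0.
rewrite (length_path R (has_path_mul (has_path_exp m hI) (has_path_exp n hJ))).
  rewrite /a /b /l /s aI bI lI sI aJ bJ lJ sJ sIJ size_cat width_cat height_cat.
  rewrite !size_flatten_nseq !width_nseq !height_nseq !mixed_catl.
  rewrite !(mixedC _ (_ ++ _)) !mixed_catl !mixed_nseq.
  rewrite !(mixedC _ (flatten (nseq m LI))) !(mixedC _ (flatten (nseq n LJ))).
  rewrite !mixed_nseq (mixedC LJ LI).
  rewrite -!natr1 !(natrD, natrM).
  by congr EFin; field.
have all_nseq' j L : all primitive L -> all primitive (flatten (nseq j L)).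
  by move=> pL; elim: j => //= j IH; rewrite all_cat pL.
by rewrite all_cat !all_nseq'.
Qed.
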